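(* Let $G=(V,E)$ be an Erdős–Rényi random graph with parameters $n$ and $p=p_n$, where $$\log^5 n\cdot n^{-1}\cdot p^{-8}\to 0\qquad (n\to\infty).$$ Then, with high probability, for every pair of vertices $w\ne v$ the hitting time $T_{w,v}$ satisfies $$\mathbb E[T_{w,v}]=\frac{2|E|}{\deg v}-1+\frac{X+Y}{X}\,1_{w\not\sim v}+o(1),$$ where $X=X_v$ and $Y=Y_v$ are random variables which, conditional on $\deg v$, are independent with $$X\sim \mathrm{Bin}\left(\deg v\,(n-\deg v-1),p\right),\qquad Y\sim\mathrm{Bin}\left((n-\deg v-1)(n-\deg v-2),p\right).$$
   Context: The Erdős–Rényi random graph with parameters $n$ and $p$ is the random simple graph on $n$ vertices in which each pair of distinct vertices is joined by an edge independently with probability $p$. ''With high probability'' means with probability tending to $1$ as $n\to\infty$. The $o(1)$ term tends to $0$ as $n\to\infty$, uniformly over all pairs $w\ne v$. For a connected graph $G$ and $w\neq v$, $T_{w,v}$ is the first time that simple random walk on $G$ started at $w$ (which at each step moves to a uniformly chosen neighbor) hits $v$; $\mathbb E[T_{w,v}]$ is the expectation over the walk, with the graph $G$ fixed. $|E|$ is the number of edges, $\deg v$ the number of neighbors of $v$, and $1_{w\not\sim v}$ is the indicator that $w$ and $v$ are not adjacent (the term containing it is $0$ when $w\sim v$). $\mathrm{Bin}(N,r)$ is the binomial distribution with $N$ trials and success probability $r$. The random variables $X,Y$ depend on $v$ and are defined on the (possibly enlarged) probability space of $G$. *)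

(* Defs.v *)
(* MathComp-Analysis *)
From mathcomp Require Import all_boot all_order all_algebra.
From mathcomp Require Import all_classical all_reals all_analysis.

Set Implicit Arguments.
Unset Strict Implicit.
Unset Printing Implicit Defensive.
Import Order.TTheory GRing.Theory Num.Theory.
Import numFieldNormedType.Exports.

Local Open Scope classical_set_scope.
Local Open Scope ring_scope.

Record sgraph (V : finType) := SGraph {
  adj :> rel V;
  adj_sym : symmetric adj;
  adj_irr : irreflexive adj }.

Section Graph.
Context (V : finType) (g : sgraph V).

Definition deg (v : V) : nat := #|[set u | adj g v u]%SET|.

Definition edges : {set {set V}} :=
  [set [set e.1; e.2]%SET | e in [pred e : V * V | adj g e.1 e.2]]%SET.

Definition connected_graph : bool := [forall x, forall y, connect (adj g) x y].

End Graph.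

Section Walk.
Context (R : realType) (V : finType) (g : sgraph V).

Definition srw_step (x y : V) : R := (adj g x y)%:R / (deg g x)%:R.

(* Probability that the walk started at x makes the successive moves to the
   vertices of s. *)
Fixpoint srw_prob (x : V) (s : seq V) : R :=
  if s is y :: s' then srw_step x y * srw_prob y s' else 1.

(* P(T_{w,v} = t): on the trajectory w :: s, whose entries are numbered from 0,
   the hitting time of v is [index v (w :: s)]. *)
Definition hit_prob (w v : V) (t : nat) : R :=
  \sum_(s : t.-tuple V | index v (w :: s) == t) srw_prob w s.

(* The last term is the contribution of the event T_{w,v} = +oo; it vanishes
   when v is hit almost surely, since +oo * 0 = 0. *)
Definition expected_hit (w v : V) : \bar R :=
  (\sum_(0 <= t <oo) (t%:R%:E * (hit_prob w v t)%:E) +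
   +oo * (1 - \sum_(0 <= t <oo) (hit_prob w v t)%:E))%E.

End Walk.

Section Probability.
Context (R : realType) (d : measure_display) (T : measurableType d).
Variable P : probability T R.

Definition erdos_renyi (n : nat) (p : R) (G : T -> sgraph 'I_n) : Prop :=
  let E (e : 'I_n * 'I_n) := [set omega | adj (G omega) e.1 e.2] in
  [/\ forall e, measurable (E e),
      forall e, e.1 != e.2 -> P (E e) = p%:E
    & (* mutual independence; each unordered pair is listed once, as i < j *)
      forall S : {set 'I_n * 'I_n}, (forall e, e \in S -> (e.1 < e.2)%N) ->
        P (\bigcap_(e in [set` S]) E e) = (\prod_(e in S) P (E e))%E].

(* P(A | B), used only for P B != 0 *)
Definition cprob (A B : set T) : R := fine (P (A `&` B)) / fine (P B).

(* Conditionally on D, X and Y are independent, X ~ Bin(N1 k, p) and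
   Y ~ Bin(N2 k, p) on the event D = k. *)
Definition cond_indep_binomials (D : T -> nat) (N1 N2 : nat -> nat) (p : R)
    (X Y : T -> nat) : Prop :=
  forall k : nat, P (D @^-1` [set k]) != 0%E ->
    [/\ forall A : set nat,
          cprob (X @^-1` A) (D @^-1` [set k]) = fine (binomial_prob (N1 k) p A),
        forall B : set nat,
          cprob (Y @^-1` B) (D @^-1` [set k]) = fine (binomial_prob (N2 k) p B)
      & forall A B : set nat,
          cprob (X @^-1` A `&` Y @^-1` B) (D @^-1` [set k]) =
          cprob (X @^-1` A) (D @^-1` [set k]) *
          cprob (Y @^-1` B) (D @^-1` [set k])].

End Probability.

(* (T', P') enlarges the probability space (T, P): pi : T' -> T is measurable
   and carries P' to P. *)
Definition enlargement (R : realType) (d d' : measure_display)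
    (T : measurableType d) (T' : measurableType d')
    (P : probability T R) (P' : probability T' R) (pi : T' -> T) : Prop :=
  measurable_fun setT pi /\
  forall A, measurable A -> pushforward P' pi A = P A.

(* Main.v *)
From HB Require Import structures.
Require Import Defs.
From mathcomp Require Import all_boot all_order all_algebra.
From mathcomp Require Import all_classical all_reals all_analysis.
From mathcomp Require Import measurable_realfun.
From mathcomp Require Import ring lra.
Set Implicit Arguments.
Unset Strict Implicit.
Unset Printing Implicit Defensive.
Import Order.TTheory GRing.Theory Num.Theory.
Import numFieldNormedType.Exports.
Local Open Scope classical_set_scope.
Local Open Scope ring_scope.

(** Fix a vertex v, let U(w) be the expected hitting time of v from w, P the
    transition matrix of the walk, and L = 2|E| / deg v.

    Off v, U solves U = 1 + P U, with U(v) = 0 ([expected_hit_system]). By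
    reversibility of the walk with respect to the degrees, this becomes
    U = 1 + P U - L 1_v on all of V; read at v, it says that U averages exactly to
    L - 1 over the neighbours of v. Iterating once gives, for w <> v,
    U(w) = 2 - L P(w, v) + (P^2 U)(w). In a dense random graph all degrees are
    about n p and all codegrees about n p^2, so that every row of P^2 is almost
    uniform and P^2 U is almost constant off v. Hence U is almost constant on the
    neighbours of v, where it must be L - 1 by the averaging identity, and larger
    by L / deg w, which is about 1/p, at the other vertices ([poisson_near]).

    It remains to compare 1/p with (X + Y) / X. The laws imposed on X and Y given
    the degree of v make both so concentrated that (X + Y) / X = 1/p + o(1) with
    high probability, whatever their dependence on the rest of the graph
    ([count_ratio_near]). They can therefore be drawn from the degree of v alone,
    with a randomness independent of the graph ([enlargement_pairs]), instead of
    being counts of edges of the graph.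

    The probabilistic input is thus a concentration bound for degrees, codegrees
    and the variables X and Y, which are all binomial at the level of moment
    generating functions ([binomial_tail], [count_mgf]), followed by a union bound
    over a number of events of order n^2, each of probability of order n^-4
    ([exists_extension]). *)

(** * Walks on finite graphs *)

(** Every edge is the image of its two orientations. *)
Lemma handshake (V : finType) (g : sgraph V) :
  (2 * #|edges g| = \sum_v deg g v)%N.
Proof.
have -> : (\sum_v deg g v = \sum_(e : V * V | adj g e.1 e.2) 1)%N.
  rewrite (eq_bigr (fun v => \sum_(u | adj g v u) 1)%N) => [|v _]; last first.
    by rewrite sum1_card /deg cardsE.
  by rewrite pair_big_dep.
rewrite (partition_big (fun e : V * V => [set e.1; e.2]%SET)
  (mem (edges g))) => [|e ge]; last exact: imset_f.
rewrite (eq_bigr (fun=> 2%N)) => [|S /imsetP[[x y] gxy ->]].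
  by rewrite sum_nat_const mulnC.
rewrite inE /= in gxy *.
have xy : x != y by apply: contraTneq gxy => ->; rewrite adj_irr.
rewrite sum1_card (@eq_card _ _ (mem [set (x, y); (y, x)]%SET)).
  by rewrite cards2 xpair_eqE (negPf xy).
move=> [a b]; rewrite !inE /= !xpair_eqE.
apply/andP/orP => [[gab /eqP abxy]|[]/andP[/eqP -> /eqP ->]]; first last.
- by rewrite adj_sym gxy finset.setUC eqxx.
- by rewrite gxy eqxx.
have ab : a != b by apply: contraTneq gab => ->; rewrite adj_irr.
have : a \in [set x; y]%SET by rewrite -abxy set21.
have : b \in [set x; y]%SET by rewrite -abxy set22.
rewrite !inE => /orP[]/eqP bE /orP[]/eqP aE; apply/orP; move: ab;
  by rewrite bE aE !eqxx ?orbT.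
Qed.

Section Stochastic.
Context (R : realType) (V : finType) (g : sgraph V).
Local Notation step := (srw_step R g).

Lemma srw_step_ge0 x y : 0 <= step x y.
Proof. by rewrite mulr_ge0// invr_ge0. Qed.

Lemma sum_adj x : \sum_y (adj g x y)%:R = (deg g x)%:R :> R.
Proof.
rewrite -natr_sum /deg cardsE -sum1_card [in RHS]big_mkcond /=.
by congr _%:R.
Qed.

Lemma deg_gt0 x y : adj g x y -> (0 < deg g x)%N.
Proof. by move=> gxy; apply/card_gt0P; exists y; rewrite inE. Qed.

Lemma deg_leq x : (deg g x <= #|V|)%N.
Proof. exact: max_card. Qed.

Lemma srw_step_sum1 x : (0 < deg g x)%N -> \sum_y step x y = 1.
Proof.
by move=> d0; rewrite -mulr_suml sum_adj divff// pnatr_eq0 -lt0n.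
Qed.

Lemma srw_step_rev x y : (0 < deg g x)%N -> (0 < deg g y)%N ->
  (deg g x)%:R * step x y = (deg g y)%:R * step y x.
Proof.
move=> dx dy; rewrite /srw_step adj_sym !(mulrCA (deg g _)%:R).
by rewrite !divff ?pnatr_eq0 -?lt0n.
Qed.

End Stochastic.

Section HittingTime.
Context (R : realType) (V : finType) (g : sgraph V) (v : V).
Local Notation step := (srw_step R g).
Local Notation f := (hit_prob R g ^~ v).

Lemma hit_prob0 w : f w 0 = (w == v)%:R.
Proof.
rewrite /hit_prob.
rewrite (eq_bigl (fun s : 0.-tuple V => w == v)) => [|s]; last first.
  by rewrite [s]tuple0 /=; case: (w == v).
case: (w == v); last by rewrite big_pred0.
rewrite (big_pred1 [tuple]) => [|s]; first by [].
by rewrite [s]tuple0 /= eqxx.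
Qed.

Lemma hit_probS w t : f w t.+1 = (w != v)%:R * \sum_y step w y * f y t.
Proof.
rewrite /hit_prob (reindex (fun q : V * t.-tuple V => [tuple of q.1 :: q.2])).
  rewrite (eq_bigl (fun q : V * t.-tuple V =>
      true && ((w != v) && (index v (q.1 :: q.2) == t)))) => [|q]; last first.
    by rewrite [LHS]/= eq_sym; case: (w =P v).
  rewrite -(pair_big_dep xpredT (fun y (s : t.-tuple V) =>
     (w != v) && (index v (y :: s) == t))
     (fun y (s : t.-tuple V) => srw_prob R g w (y :: s))) /=.
  case: (w =P v) => _ /=; last first.
    by rewrite mul1r; apply: eq_bigr => y _; rewrite mulr_sumr.
  by rewrite mul0r big1// => y _; rewrite big_pred0.
exists (fun s => (thead s, [tuple of behead s])) => [[y s] _|s _] /=.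
  by congr pair; apply/val_inj.
by rewrite [RHS]tuple_eta.
Qed.

End HittingTime.

(** * The equation of expected hitting times *)

Section HittingTimeSystem.
Context (R : realType) (V : finType) (g : sgraph V) (v : V).
Hypothesis diam2 : forall w, w != v -> exists u, adj g w u && adj g u v.
Local Notation step := (srw_step R g).
Local Notation f := (hit_prob R g ^~ v).
Local Notation N := (#|V|%:R : R).

Let deg0 w : w != v -> (0 < deg g w)%N.
Proof. by move=> /diam2[u /andP[/deg_gt0]]. Qed.

Let V1 : 1 <= N.
Proof. by rewrite ler1n; apply/card_gt0P; exists v. Qed.

Let K : R := N ^+ 2 + N.

(* A bounded supersolution of the equation of expected hitting times: each
   step lowers [phi] by at least 1 on average. The drop N on the neighbours of v
   pays for the vertices that only reach them, and K for the jump to 0 at v. *)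
Let phi w : R := if w == v then 0 else K - N * (adj g w v)%:R.

Let phi_le w : phi w <= K - N * (adj g w v)%:R.
Proof.
rewrite /phi; case: eqP => // ->; rewrite adj_irr mulr0 subr0 /K.
by rewrite addr_ge0 ?exprn_ge0.
Qed.

Let phi_ge0 w : 0 <= phi w.
Proof.
rewrite /phi; case: eqP => // _; have := V1; rewrite /K.
by case: (adj g w v) => /=; nra.
Qed.

Let phi_ge1 w : w != v -> 1 <= phi w.
Proof.
rewrite /phi => /negPf->; have := V1; rewrite /K.
by case: (adj g w v) => /=; nra.
Qed.

Let inv_deg w : w != v -> 1 <= N * (deg g w)%:R^-1.
Proof.
move=> wv; rewrite ler_pdivlMr ?ltr0n ?deg0// mul1r ler_nat; exact: deg_leq.
Qed.

Let step_phi w : w != v -> \sum_y step w y * phi y <= phi w - 1.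
Proof.
move=> wv; have dw := deg0 wv; have inv := inv_deg wv.
rewrite [in leRHS]/phi (negPf wv); case: (boolP (adj g w v)) => gwv /=.
  rewrite (bigD1 v)//= {1}/phi eqxx mulr0 add0r.
  apply: (@le_trans _ _ (\sum_(y | y != v) step w y * K)).
    apply: ler_sum => y _; rewrite ler_wpM2l ?srw_step_ge0//.
    by rewrite (le_trans (phi_le y))// gerBl mulr_ge0.
  rewrite -mulr_suml.
  have := srw_step_sum1 R dw; rewrite (bigD1 v)//= => /(canRL (addKr _)) ->.
  rewrite /srw_step gwv mul1r mulr1 /K; move: inv; set i := (deg g w)%:R^-1.
  rewrite -subr_ge0 => inv.
  have : 0 <= (N * i - 1) * (N + 1) by rewrite mulr_ge0// addr_ge0.
  by lra.
apply: (@le_trans _ _ (\sum_y (step w y * K - N * (step w y * (adj g y v)%:R)))).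
  apply: ler_sum => y _; rewrite [N * _]mulrCA -mulrBr.
  by rewrite ler_wpM2l ?srw_step_ge0.
rewrite sumrB -mulr_suml srw_step_sum1// mul1r mulr0 subr0 lerD2l lerN2.
rewrite -mulr_sumr; apply: le_trans inv _; rewrite ler_wpM2l//.
have [u /andP[gwu guv]] := diam2 wv.
rewrite (bigD1 u)//= /srw_step gwu guv mul1r mulr1 lerDl.
by apply: sumr_ge0 => y _; rewrite !mulr_ge0 ?invr_ge0.
Qed.

(* [F n w] is the probability that v is hit before time n, and [u n w] the
   corresponding part of the expected hitting time. *)
Let F n w := \sum_(0 <= t < n) f w t.
Let u n w := \sum_(0 <= t < n) t%:R * f w t.

Let f_ge0 w t : 0 <= f w t.
Proof.
elim: t w => [|t IH] w; first by rewrite hit_prob0.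
by rewrite hit_probS mulr_ge0// sumr_ge0// => y _; rewrite mulr_ge0// srw_step_ge0.
Qed.

Let FS n w : F n.+1 w =
  (w == v)%:R + (w != v)%:R * \sum_y step w y * F n y.
Proof.
rewrite /F big_nat_recl// hit_prob0; congr +%R.
under eq_bigr do rewrite hit_probS.
rewrite -mulr_sumr exchange_big /=; congr *%R.
by apply: eq_bigr => y _; rewrite mulr_sumr.
Qed.

Let uS n w : u n.+1 w = (w != v)%:R * \sum_y step w y * (F n y + u n y).
Proof.
rewrite /u big_nat_recl// mul0r add0r.
under eq_bigr do rewrite hit_probS mulrCA.
rewrite -mulr_sumr; congr *%R.
under eq_bigr do rewrite mulr_sumr.
rewrite exchange_big /=; apply: eq_bigr => y _.
rewrite /F -big_split mulr_sumr /=; apply: eq_bigr => t _.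
by rewrite -[in LHS]natr1; ring.
Qed.

(* Since phi <= K, losing 1 per step means losing a fraction 1/K. *)
Let rho : R := 1 - K^-1.

Let K_gt0 : 0 < K. Proof. by have := V1; rewrite /K; nra. Qed.

Let rho_ge0 : 0 <= rho.
Proof. by rewrite subr_ge0 invf_le1//; have := V1; rewrite /K; nra. Qed.

Let rho_lt1 : rho < 1. Proof. by rewrite gtrBl invr_gt0. Qed.

Let phi_rho w : phi w - 1 <= rho * phi w.
Proof.
rewrite mulrBl mul1r lerD2l lerN2 ler_pdivrMl// mulr1.
by rewrite (le_trans (phi_le w))// gerBl mulr_ge0.
Qed.

Let F_v n : F n.+1 v = 1.
Proof. by rewrite FS eqxx mul0r addr0. Qed.

Let F_tail n w : 0 <= 1 - F n.+1 w <= rho ^+ n * phi w.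
Proof.
elim: n w => [|n IH] w.
  rewrite /F big_nat1 hit_prob0 mul1r; have [->|wv] := eqVneq w v.
    by rewrite subrr lexx phi_ge0.
  by rewrite subr0 ler01 phi_ge1.
have [->|wv] := eqVneq w v.
  by rewrite F_v subrr lexx mulr_ge0 ?exprn_ge0.
have -> : 1 - F n.+2 w = \sum_y step w y * (1 - F n.+1 y).
  rewrite FS (negPf wv) add0r mul1r -{1}(srw_step_sum1 R (deg0 wv)) -sumrB.
  by apply: eq_bigr => y _; rewrite mulrBr mulr1.
rewrite sumr_ge0 => [|y _]; last first.
  by have /andP[? _] := IH y; rewrite mulr_ge0 ?srw_step_ge0.
apply: (@le_trans _ _ (\sum_y rho ^+ n * (step w y * phi y))).
  apply: ler_sum => y _; rewrite mulrCA ler_wpM2l ?srw_step_ge0//.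
  by have /andP[] := IH y.
rewrite -mulr_sumr exprSr -mulrA ler_wpM2l ?exprn_ge0//.
exact: le_trans (step_phi wv) (phi_rho w).
Qed.

Let F_le1 n w : F n w <= 1.
Proof.
case: n => [|n]; first by rewrite /F big_nil.
by have /andP[+ _] := F_tail n w; rewrite subr_ge0.
Qed.

Let u_le n w : u n w <= phi w.
Proof.
elim: n w => [|n IH] w; first by rewrite /u big_nil phi_ge0.
rewrite uS; have [->|wv] := eqVneq w v; first by rewrite mul0r phi_ge0.
rewrite mul1r; under eq_bigr do rewrite mulrDr.
rewrite big_split /=.
have : \sum_y step w y * F n y <= 1.
  rewrite -(srw_step_sum1 R (deg0 wv)); apply: ler_sum => y _.
  by rewrite ler_piMr ?srw_step_ge0.
have : \sum_y step w y * u n y <= \sum_y step w y * phi y.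
  by apply: ler_sum => y _; rewrite ler_wpM2l ?srw_step_ge0.
by have := step_phi wv; lra.
Qed.

Let u_nd w : {homo u^~ w : m n / (m <= n)%N >-> m <= n}.
Proof.
apply/nondecreasing_seqP => n; rewrite /u big_nat_recr//= lerDl.
by rewrite mulr_ge0.
Qed.

Let u_cvg w : cvgn (u^~ w).
Proof.
apply: nondecreasing_is_cvgn; first exact: u_nd.
by exists (phi w) => _ [n _ <-]; exact: u_le.
Qed.

Let F_cvg w : F^~ w @ \oo --> (1 : R).
Proof.
rewrite -cvg_shiftS /=; apply/cvgrPdist_le => e e0.
have : (fun n => rho ^+ n * phi w) @ \oo --> (0 : R).
  rewrite -(mul0r (phi w)); apply: cvgMl.
  by apply: cvg_expr; rewrite ger0_norm.
move=> /cvgrPdist_le /(_ _ e0); apply: filterS => n; rewrite sub0r normrN.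
move=> le_e; have /andP[F0 F1] := F_tail n w; rewrite ger0_norm//.
exact: le_trans F1 (le_trans (ler_norm _) le_e).
Qed.

(** The supersolution [phi] makes the survival probabilities decay geometrically,
    so v is hit almost surely and the infinite term of [expected_hit] vanishes;
    it also bounds the truncated expectations [u], whose recursion passes to the
    limit. *)
Lemma expected_hit_system : exists U : V -> R,
  [/\ forall w, expected_hit R g w v = (U w)%:E, U v = 0
    & forall w, w != v -> U w = 1 + \sum_y step w y * U y].
Proof.
pose U w := limn (u^~ w).
exists U; split => [w||w wv].
- rewrite /expected_hit.
  have -> : (\sum_(0 <= t <oo) (t%:R%:E * (f w t)%:E) = (U w)%:E)%E.
    rewrite /U -EFin_lim//; congr (limn _); apply/funext => n /=.
    by rewrite -sumEFin.
  have -> : (\sum_(0 <= t <oo) (f w t)%:E = 1)%E.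
    rewrite -[RHS]/((1 : R)%:E) -(cvg_lim _ (@F_cvg w))// -EFin_lim.
      by congr (limn _); apply/funext => n /=; rewrite -sumEFin.
    by apply/cvg_ex; exists 1; exact: F_cvg.
  by rewrite subee// mule0 adde0.
- apply: cvg_lim => //; rewrite -cvg_shiftS /=.
  under eq_fun do rewrite uS eqxx mul0r.
  exact: cvg_cst.
- apply: cvg_lim => //; rewrite -cvg_shiftS /=.
  under eq_fun do rewrite uS wv mul1r.
  have -> : 1 + \sum_y step w y * U y = \sum_y step w y * (1 + U y).
    rewrite -{1}(srw_step_sum1 R (deg0 wv)) -big_split /=.
    by apply: eq_bigr => y _; rewrite mulrDr mulr1.
  apply: cvg_big => [|y _]; first exact: add_continuous.
  by apply: cvgMr; apply: cvgD => //; exact: F_cvg.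
Qed.

End HittingTimeSystem.

(** * Solutions of the Poisson equation on nearly regular dense graphs *)

Definition codeg (V : finType) (g : sgraph V) (w z : V) : nat :=
  #|[set u | adj g w u && adj g u z]%SET|.

Lemma scale_gt0 (R : realType) (N p k : R) :
  0 < p -> 0 <= N -> 1 <= k * N * p ^+ 3 -> 0 < N /\ 0 < k.
Proof.
move=> p0 N_ge0 k_large.
have N0 : 0 < N.
  rewrite lt0r N_ge0 andbT; apply/eqP => N0.
  by move: k_large; rewrite N0 mulr0 mul0r; lra.
split => //; have : 0 < k * (N * p ^+ 3) by rewrite mulrA (lt_le_trans _ k_large).
by rewrite pmulr_lgt0// mulr_gt0// exprn_gt0.
Qed.

(** The hypotheses compare degrees with n p and codegrees with n p^2 at the same
    absolute precision k n p^3. The relative error is then theta = k p^2 for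
    degrees and k p for codegrees, hence of order k p for the rows of the two-step
    kernel; the factor p is there because hitting times of v oscillate by about
    1/p. *)
Section Poisson.
Context (R : realType) (V : finType) (g : sgraph V) (p k : R).
Local Notation step := (srw_step R g).
Local Notation N := (#|V|%:R : R).
Local Notation dg w := ((deg g w)%:R : R).
Hypotheses (p01 : 0 < p <= 1) (k_small : k <= 100^-1)
  (k_large : 1 <= k * N * p ^+ 3)
  (deg_conc : forall w, `|dg w - N * p| <= k * N * p ^+ 3)
  (codeg_conc : forall w z, w != z ->
     `|(codeg g w z)%:R - N * p ^+ 2| <= k * N * p ^+ 3).

Let D := N * p.
Let theta := k * p ^+ 2.

Let p0 : 0 < p. Proof. by case/andP: p01. Qed.
Let p1 : p <= 1. Proof. by case/andP: p01. Qed.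

Let N0 : 0 < N. Proof. by have [] := scale_gt0 p0 (ler0n _ _) k_large. Qed.
Let k0 : 0 < k. Proof. by have [] := scale_gt0 p0 (ler0n _ _) k_large. Qed.

Let theta_le : 0 < theta <= k * p.
Proof.
rewrite mulr_gt0 ?exprn_gt0//= ler_wpM2l ?(ltW k0)//.
by rewrite expr2 ger_pMl.
Qed.

Let kp_le : k * p <= 100^-1.
Proof. by apply: le_trans _ k_small; rewrite ger_pMr. Qed.

Let D0 : 0 < D. Proof. exact: mulr_gt0. Qed.

Let kNp3 : k * N * p ^+ 3 = theta * D.
Proof. by rewrite /theta /D; ring. Qed.

Let invD : D^-1 <= theta.
Proof. by rewrite -[leLHS]mul1r ler_pdivrMr// -kNp3. Qed.

Let deg_bounds w : (1 - theta) * D <= dg w <= (1 + theta) * D.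
Proof.
have := deg_conc w; rewrite kNp3 -/D ler_distl.
by case/andP => ? ?; apply/andP; split; lra.
Qed.

Let deg_big w : 99/100 * D <= dg w.
Proof.
have /andP[+ _] := deg_bounds w; apply: le_trans; rewrite ler_wpM2r ?(ltW D0)//.
by move: theta_le kp_le; lra.
Qed.

Let dgR0 w : 0 < dg w.
Proof. by apply: lt_le_trans (deg_big w); rewrite mulr_gt0. Qed.

Let dg0 w : (0 < deg g w)%N.
Proof. by rewrite -(ltr0n R). Qed.

Let inv_dg w : (dg w)^-1 <= 101/99 / D.
Proof.
rewrite -[101/99 / D]invrK lef_pV2 ?posrE// ?invr_gt0 ?mulr_gt0 ?invr_gt0//.
rewrite invfM invrK; apply: le_trans (deg_big w); rewrite ler_wpM2r ?(ltW D0)//.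
by lra.
Qed.

Let inv_dg_conc w : `|D / dg w - 1| <= 100/99 * theta.
Proof.
have -> : D / dg w - 1 = - ((dg w - D) / dg w) by field; rewrite gt_eqF.
rewrite normrN normrM normfV [`|dg w|]ger0_norm// ler_pdivrMr//.
have := deg_conc w; rewrite kNp3 -/D => /le_trans; apply.
have : 0 <= theta * (dg w - 99/100 * D).
  by rewrite mulr_ge0 ?subr_ge0 ?deg_big ?ltW//; case/andP: theta_le.
by lra.
Qed.

Let inv_dg2_conc w u : `|D / dg w * (D / dg u) - 1| <= 3 * theta.
Proof.
have := inv_dg_conc w; have := inv_dg_conc u; have := theta_le; have := kp_le.
set a := D / dg w; set b := D / dg u => kp1 /andP[t0 tkp] b1 a1.
have -> : a * b - 1 = (a - 1) * (b - 1) + (a - 1) + (b - 1) by ring.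
have ab : `|(a - 1) * (b - 1)| <= 100/99 * theta * (100/99 * theta).
  by rewrite normrM ler_pM.
have tt : theta * theta <= theta * 100^-1.
  by rewrite ler_wpM2l ?(ltW t0)//; lra.
have := ler_normD ((a - 1) * (b - 1) + (a - 1)) (b - 1).
have := ler_normD ((a - 1) * (b - 1)) (a - 1).
lra.
Qed.

(* The expected return time to v, since the sum of the degrees is 2|E|. *)
Let L v := (\sum_w dg w) / dg v.

Let L_step v w : `|L v / dg w - p^-1| <= 5 * k.
Proof.
have sum_conc : `|\sum_u dg u - N * D| <= N * (theta * D).
  have -> : N * D = \sum_(u : V) D by rewrite sumr_const mulr_natl.
  have -> : N * (theta * D) = \sum_(u : V) theta * D.
    by rewrite sumr_const mulr_natl.
  rewrite -sumrB (le_trans (ler_norm_sum _ _ _))//; apply: ler_sum => u _.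
  by rewrite -kNp3 deg_conc.
set S := \sum_u dg u in sum_conc *.
pose c := D / dg v * (D / dg w).
have -> : L v / dg w - p^-1 = (S * (c - 1) + (S - N * D)) / D ^+ 2.
  rewrite /L /c -/S /D; field.
  by rewrite !gt_eqF.
rewrite normrM [`|_^-1|]ger0_norm ?invr_ge0 ?exprn_ge0 ?(ltW D0)//.
rewrite ler_pdivrMr ?exprn_gt0//.
apply: (@le_trans _ _ (5 * theta * (N * D))); last first.
  rewrite /theta /D.
  have -> : 5 * (k * p ^+ 2) * (N * (N * p)) = 5 * k * (N * p) ^+ 2 * p by ring.
  by rewrite ger_pMr// !mulr_gt0 ?exprn_gt0.
apply: le_trans (ler_normD _ _) _.
have S0 : 0 <= S by apply: sumr_ge0.
have Sc : `|S * (c - 1)| <= S * (3 * theta).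
  by rewrite normrM ger0_norm// ler_wpM2l ?inv_dg2_conc.
have /andP[t0 tkp] := theta_le.
have ND0 : 0 < N * D by rewrite mulr_gt0.
have S_le : S <= 101/100 * (N * D).
  have : theta * (N * D) <= 100^-1 * (N * D).
    by rewrite ler_wpM2r ?(ltW ND0)// (le_trans tkp kp_le).
  by move: sum_conc; rewrite ler_norml => /andP[_]; lra.
have := ler_wpM2r (ltW t0) S_le.
have : 0 < theta * (N * D) by rewrite mulr_gt0.
by move: sum_conc Sc; set x := `|_|; set y := `|_|; lra.
Qed.

(* The two-step kernel of the walk. *)
Let q w z := \sum_u step w u * step u z.

Let q_ge0 w z : 0 <= q w z.
Proof. by apply: sumr_ge0 => u _; rewrite mulr_ge0 ?srw_step_ge0. Qed.

Let q_sum1 w : \sum_z q w z = 1.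
Proof.
rewrite exchange_big /= -[RHS](srw_step_sum1 R (dg0 w)); apply: eq_bigr => u _.
by rewrite -mulr_sumr srw_step_sum1// mulr1.
Qed.

Let q_diag w : q w w <= 2 / D.
Proof.
apply: (@le_trans _ _ (\sum_u step w u * (101/99 / D))).
  apply: ler_sum => u _; rewrite ler_wpM2l ?srw_step_ge0//.
  apply: le_trans _ (inv_dg u).
  by rewrite /srw_step ler_piMl ?invr_ge0//; case: adj.
rewrite -mulr_suml srw_step_sum1// mul1r ler_wpM2r ?invr_ge0 ?(ltW D0)//.
by lra.
Qed.

Let q_conc w z : w != z -> `|q w z - N^-1| <= 5 * k * p / N.
Proof.
move=> wz; pose C := [set u | adj g w u && adj g u z]%SET.
pose e u := D / dg w * (D / dg u).
have qE : q w z = (\sum_(u in C) e u) / D ^+ 2.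
  rewrite /q (bigID (mem C)) /= [X in _ + X]big1 ?addr0 => [|u]; last first.
    by rewrite inE /srw_step; case: adj; case: adj; rewrite //= ?mul0r ?mulr0.
  rewrite mulr_suml; apply: eq_bigr => u; rewrite inE => /andP[gwu guz].
  rewrite /e /srw_step gwu guz /=; field.
  by rewrite !gt_eqF.
have cE : (codeg g w z)%:R = \sum_(u in C) 1 :> R by rewrite sumr_const.
have qc : `|\sum_(u in C) e u - (codeg g w z)%:R| <= (codeg g w z)%:R * (3 * theta).
  rewrite cE -sumrB mulr_suml (le_trans (ler_norm_sum _ _ _))//.
  by apply: ler_sum => u _; rewrite mul1r inv_dg2_conc.
have -> : q w z - N^-1 =
    (\sum_(u in C) e u - (codeg g w z)%:R
     + ((codeg g w z)%:R - N * p ^+ 2)) / D ^+ 2.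
  by rewrite qE /D; field; rewrite !gt_eqF.
rewrite normrM [`|_^-1|]ger0_norm ?invr_ge0 ?exprn_ge0 ?(ltW D0)//.
rewrite ler_pdivrMr ?exprn_gt0//.
have -> : 5 * k * p / N * D ^+ 2 = 5 * (k * p * (N * p ^+ 2)).
  by rewrite /D; field; rewrite gt_eqF.
apply: le_trans (ler_normD _ _) _.
have := codeg_conc wz; have -> : k * N * p ^+ 3 = k * p * (N * p ^+ 2) by ring.
move=> cc; have Np2 : 0 < N * p ^+ 2 by rewrite mulr_gt0 ?exprn_gt0.
have c_le : (codeg g w z)%:R <= 101/100 * (N * p ^+ 2).
  have := ler_wpM2r (ltW Np2) kp_le.
  by move: cc; rewrite ler_norml => /andP[_]; lra.
have /andP[t0 tkp] := theta_le.
have : (codeg g w z)%:R * theta <= 101/100 * (N * p ^+ 2) * (k * p).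
  by rewrite ler_pM// ltW.
have : 0 < k * p * (N * p ^+ 2) by rewrite !mulr_gt0.
by move: cc qc; set x := `|_|; set y := `|_|; lra.
Qed.

Let q_row v w : \sum_(z | z != v) `|q w z - N^-1| <= 8 * (k * p).
Proof.
have row : \sum_(z | z != w) `|q w z - N^-1| <= 5 * (k * p).
  apply: (@le_trans _ _ (\sum_(z : V) 5 * k * p / N)).
    rewrite [leRHS](bigID (predC1 w)) /=.
    rewrite -[leLHS]addr0 lerD//; last first.
      by apply: sumr_ge0 => z _; rewrite !mulr_ge0 ?invr_ge0 ?ltW.
    by apply: ler_sum => z zw; rewrite q_conc// eq_sym.
  have -> : \sum_(z : V) 5 * k * p / N = 5 * k * p / N * N.
    by rewrite sumr_const mulr_natr.
  by rewrite divfK ?gt_eqF// mulrA.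
have diag : `|q w w - N^-1| <= 3 * (k * p).
  apply: le_trans (ler_normB _ _) _.
  rewrite !ger0_norm ?invr_ge0 ?q_ge0 ?(ltW N0)//.
  have NV : N^-1 <= D^-1.
    by rewrite lef_pV2 ?posrE// /D ger_pMr.
  by have := q_diag w; have := invD; have /andP[_] := theta_le; lra.
apply: (@le_trans _ _ (\sum_z `|q w z - N^-1|)).
  rewrite [leRHS](bigID (predC1 v)) /= lerDl; exact: sumr_ge0.
rewrite (bigD1 w)//=.
by move: row diag; set x := `|_|; set y := bigop.body _ _ _; lra.
Qed.


Section Solution.
Variables (v : V) (U : V -> R).
Hypotheses (Uv : U v = 0)
  (U_eq : forall w, w != v -> U w = 1 + \sum_y step w y * U y).

(* Pair the equation with the degrees, which are a reversible measure: the terms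
   of P U cancel except at v, where the equation is not assumed. *)
Let U_avg : 1 + \sum_y step v y * U y = L v.
Proof.
have : \sum_w dg w * U w = \sum_w dg w * \sum_y step w y * U y.
  under [RHS]eq_bigr do rewrite mulr_sumr.
  rewrite exchange_big /=; apply: eq_bigr => y _.
  under eq_bigr do rewrite mulrA srw_step_rev// -mulrA.
  rewrite -mulr_sumr -mulr_suml srw_step_sum1//.
  by rewrite mul1r.
rewrite (bigD1 v)//= Uv mulr0 add0r [RHS](bigD1 v)//=.
under eq_bigr => w wv do rewrite (U_eq wv) mulrDr mulr1.
rewrite big_split /= => e.
apply: (mulfI (lt0r_neq0 (dgR0 v))); rewrite /L mulrCA divff ?lt0r_neq0//.
rewrite mulr1 [RHS](bigD1 v)//= mulrDr mulr1; congr (_ + _).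
by move: e => /addIr.
Qed.

Let U_eqT w : U w = 1 + \sum_y step w y * U y - L v * (w == v)%:R.
Proof.
have [->|wv] := eqVneq w v; last by rewrite U_eq// mulr0 subr0.
by rewrite U_avg mulr1 subrr.
Qed.

Let U_two_step w : w != v ->
  U w = 2 - L v * step w v + \sum_z q w z * U z.
Proof.
move=> wv; rewrite U_eq//.
under eq_bigr => y _ do rewrite {1}U_eqT mulrBr mulrDr mulr1.
rewrite sumrB big_split /= srw_step_sum1//.
have -> : \sum_y step w y * (L v * (y == v)%:R) = L v * step w v.
  rewrite (bigD1 v)//= eqxx mulr1 big1 ?addr0 => [|y /negPf->]; first exact: mulrC.
  by rewrite !mulr0.
have -> : \sum_y step w y * (\sum_z step y z * U z) = \sum_z q w z * U z.
  under eq_bigr do rewrite mulr_sumr.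
  rewrite exchange_big /=; apply: eq_bigr => z _.
  by rewrite mulr_suml; apply: eq_bigr => y _; rewrite mulrA.
by ring.
Qed.

Let m := L v - 1.

(* The oscillation of U off v. *)
Let O := \big[Num.max/0]_(e : V * V | (e.1 != v) && (e.2 != v)) `|U e.1 - U e.2|.

Let O_ge0 : 0 <= O. Proof. exact: bigmax_ge_id. Qed.

Let O_max w z : w != v -> z != v -> `|U w - U z| <= O.
Proof.
move=> wv zv.
by apply: (@le_bigmax_cond _ _ _ _ (w, z)); rewrite /= wv.
Qed.

Let m_avg : \sum_y step v y * U y = m.
Proof. by rewrite /m -U_avg addrAC subrr add0r. Qed.

Let avg_near c e : (forall y, adj g v y -> `|U y - c| <= e) -> `|m - c| <= e.
Proof.
move=> Uc.
have -> : m - c = \sum_y step v y * (U y - c).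
  under eq_bigr do rewrite mulrBr.
  by rewrite sumrB m_avg -mulr_suml srw_step_sum1// mul1r.
have -> : e = \sum_y step v y * e by rewrite -mulr_suml srw_step_sum1// mul1r.
apply: le_trans (ler_norm_sum _ _ _) _; apply: ler_sum => y _.
rewrite normrM ger0_norm ?srw_step_ge0// /srw_step.
case: (boolP (adj g v y)) => [/Uc|_]; last by rewrite !mul0r.
by move=> ?; rewrite ler_wpM2l// mulr_ge0// invr_ge0.
Qed.

Let O_m z : z != v -> `|U z - m| <= O.
Proof.
move=> zv; rewrite distrC; apply: avg_near => y gvy; apply: O_max => //.
by apply: contraTneq gvy => ->; rewrite adj_irr.
Qed.

Let m_bound : `|m| <= 2 * N.
Proof.
have : L v <= 106/100 * (101/100 * N).
  have := L_step v v; rewrite ler_norml => /andP[_ LU].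
  have Lp : L v / dg v <= 105/100 / p.
    have : 1 <= p^-1 by rewrite invf_ge1.
    by move: LU k_small; lra.
  have -> : L v = L v / dg v * dg v by rewrite mulfVK ?gt_eqF.
  apply: (@le_trans _ _ (105/100 / p * (101/100 * D))).
    rewrite ler_pM//.
    - by rewrite !mulr_ge0 ?invr_ge0// sumr_ge0.
    - have /andP[_] := deg_bounds v; move=> /le_trans; apply.
      by rewrite ler_wpM2r ?(ltW D0)//; have := theta_le; have := kp_le; lra.
  have -> : 105/100 / p * (101/100 * D) = 105/100 * (101/100 * N).
    by rewrite /D; field; rewrite gt_eqF.
  by move: N0; lra.
have : 1 <= L v.
  rewrite ler_pdivlMr// mul1r (bigD1 v)//= lerDl; exact: sumr_ge0.
by rewrite /m ler_norml => ? ?; apply/andP; split; move: N0; lra.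
Qed.

(* The rows of [q] are within 8 k p of uniform off v, where U - m is at most O;
   at v the deviation is 5 k p / N, but U - m = - m is as large as 2 N. *)
Let E := 8 * (k * p) * O + 10 * (k * p).

Let J := N^-1 * \sum_z (U z - m).

Let q_near w : w != v -> `|\sum_z q w z * U z - (m + J)| <= E.
Proof.
move=> wv.
have -> : \sum_z q w z * U z - (m + J) = \sum_z (q w z - N^-1) * (U z - m).
  under [RHS]eq_bigr do rewrite mulrBl.
  rewrite sumrB -mulr_sumr -/J opprD addrA; congr (_ - J).
  under [RHS]eq_bigr do rewrite mulrBr.
  by rewrite sumrB -mulr_suml q_sum1 mul1r.
apply: le_trans (ler_norm_sum _ _ _) _; rewrite (bigD1 v)//= addrC.
apply: lerD.
  apply: (@le_trans _ _ (\sum_(z | z != v) `|q w z - N^-1| * O)).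
    by apply: ler_sum => z zv; rewrite normrM ler_wpM2l ?O_m.
  by rewrite -mulr_suml ler_wpM2r ?q_row.
rewrite Uv sub0r normrM normrN.
apply: (@le_trans _ _ (5 * k * p / N * (2 * N))); first by rewrite ler_pM ?q_conc.
by rewrite le_eqVlt; apply/orP; left; apply/eqP; field; rewrite gt_eqF.
Qed.

Let C := 2 + m + J.

Let U_near_step w : w != v -> `|U w - (C - L v * step w v)| <= E.
Proof.
move=> wv; rewrite (U_two_step wv).
rewrite [X in `|X|](_ : _ = \sum_z q w z * U z - (m + J)); first exact: q_near.
by rewrite /C; ring.
Qed.

Let L_step_le w : 0 <= L v * step w v <= 105/100 / p.
Proof.
have := L_step v w; rewrite ler_norml => /andP[_ LU].
have Lp : L v / dg w <= 105/100 / p.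
  have : 1 <= p^-1 by rewrite invf_ge1.
  by move: LU k_small; lra.
have L0 : 0 <= L v / dg w by rewrite !mulr_ge0 ?invr_ge0// sumr_ge0.
rewrite /srw_step; case: adj; rewrite ?mul1r ?L0//= mul0r mulr0 lexx /=.
exact: le_trans Lp.
Qed.

(* U is within E of C - L P(., v), whose oscillation is about 1/p; as E contains O
   with the small factor 8 k p, this closes into a bound on O. *)
Let kpO : k * p * O <= 2 * k.
Proof.
have E_ge0 : 0 <= E by rewrite /E addr_ge0// !mulr_ge0 ?(ltW k0) ?(ltW p0).
have p1V : 1 <= p^-1 by rewrite invf_ge1.
have O_le : O <= 105/100 / p + 2 * E.
  apply: bigmax_le => [|[w z] /= /andP[wv zv]].
    have : 0 <= 105/100 / p :> R by rewrite mulr_ge0 ?invr_ge0 ?(ltW p0)//; lra.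
    by move: E_ge0; lra.
  have := U_near_step wv; have := U_near_step zv.
  have := L_step_le w; have := L_step_le z.
  rewrite !ler_norml => /andP[? ?] /andP[? ?] /andP[? ?] /andP[? ?].
  by apply/andP; split; lra.
have : k * p * O <= 100^-1 * O by rewrite ler_wpM2r.
move=> kpO.
have : O <= 2 / p by move: O_le p1V kp_le; rewrite /E; lra.
move=> /(ler_wpM2l (ltW k0)) /(ler_wpM2l (ltW p0)).
rewrite [p * (k * (2 / p))](_ : _ = 2 * k); last by field; rewrite gt_eqF.
by rewrite mulrA [p * k]mulrC.
Qed.

Let E_le : E <= 26 * k.
Proof.
have : k * p <= k by rewrite ger_pMr.
by move: kpO; rewrite /E; lra.
Qed.

Let U_near w : w != v -> `|U w - (C - (adj g w v)%:R / p)| <= 31 * k.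
Proof.
move=> wv; have := U_near_step wv; have := L_step v w; have := E_le.
rewrite /srw_step; case: adj; rewrite ?mul1r ?mul0r ?mulr0 ?subr0.
  rewrite !ler_norml => ? /andP[? ?] /andP[? ?].
  by apply/andP; split; lra.
by move=> ? _ /le_trans; apply; move: k0; lra.
Qed.

(** Off v, U is nearly C - 1/p on the neighbours of v and C elsewhere, by
    [U_near]; its average over the neighbours being exactly L - 1, C is nearly
    L - 1 + 1/p. *)
Lemma poisson_near w : w != v ->
  `|U w - ((\sum_w dg w) / dg v - 1 + (~~ adj g w v)%:R / p)| <= 62 * k.
Proof.
move=> wv; rewrite -/(L v) -/m.
have : `|m - (C - p^-1)| <= 31 * k.
  apply: avg_near => y gvy.
  have yv : y != v by apply: contraTneq gvy => ->; rewrite adj_irr.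
  by have := U_near yv; rewrite adj_sym gvy mul1r.
have := U_near wv; case: adj; rewrite /= ?mul1r ?mul0r ?subr0 ?addr0.
  rewrite !ler_norml => /andP[? ?] /andP[? ?].
  by apply/andP; split; lra.
rewrite !ler_norml => /andP[? ?] /andP[? ?].
by apply/andP; split; lra.
Qed.

End Solution.

End Poisson.

(** * Hitting times on pseudorandom graphs *)

Definition pseudorandom (R : realType) (V : finType) (p k : R) (g : sgraph V) :=
  (forall w, `|(deg g w)%:R - #|V|%:R * p| <= k * #|V|%:R * p ^+ 3) /\
  (forall w z, w != z ->
     `|(codeg g w z)%:R - #|V|%:R * p ^+ 2| <= k * #|V|%:R * p ^+ 3).

Section Deterministic.
Context (R : realType) (V : finType) (g : sgraph V) (p k : R).
Local Notation N := (#|V|%:R : R).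
Hypotheses (p01 : 0 < p <= 1) (k_small : k <= 100^-1)
  (k_large : 1 <= k * N * p ^+ 3) (g_pr : pseudorandom p k g).

Let p0 : 0 < p. Proof. by case/andP: p01. Qed.
Let p1 : p <= 1. Proof. by case/andP: p01. Qed.
Let N0 : 0 < N. Proof. by have [] := scale_gt0 p0 (ler0n _ _) k_large. Qed.
Let k0 : 0 < k. Proof. by have [] := scale_gt0 p0 (ler0n _ _) k_large. Qed.
Let kp : k * p <= 100^-1.
Proof. by apply: le_trans _ k_small; rewrite ger_pMr. Qed.

Lemma pseudorandom_codeg_gt0 w z : w != z -> exists u, adj g w u && adj g u z.
Proof.
move=> /(g_pr.2) cwz.
have c0 : 0 < (codeg g w z)%:R :> R.
  have Np2 : 0 < N * p ^+ 2 by rewrite mulr_gt0 ?exprn_gt0.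
  move: cwz; rewrite ler_norml => /andP[+ _].
  have -> : k * N * p ^+ 3 = k * p * (N * p ^+ 2) by ring.
  have := ler_wpM2r (ltW Np2) kp; lra.
move: c0; rewrite ltr0n => /card_gt0P[u]; rewrite inE => gu; by exists u.
Qed.

Lemma pseudorandom_connected : connected_graph g.
Proof.
apply/forallP => x; apply/forallP => z; have [->//|xz] := eqVneq x z.
have [u /andP[xu uz]] := pseudorandom_codeg_gt0 xz.
exact: connect_trans (connect1 xu) (connect1 uz).
Qed.

(** The means of x and y are p d b and p b (b - 1) with b = n - d - 1, so x + y has
    mean p b (n - 2), which is x / p on average because d is about n p. *)
Lemma count_ratio_near (v : V) (x y : nat) (b := (#|V| - deg g v - 1)%N) :
  (0 < b)%N ->
  `|x%:R - p * (deg g v * b)%:R| <= k * N * p ^+ 3 * b%:R ->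
  `|y%:R - p * (b * b.-1)%:R| <= k * N * p ^+ 3 * b%:R ->
  x != 0%N /\ `|(x + y)%:R / x%:R - p^-1| <= 6 * k.
Proof.
move=> b_gt0.
have b1 : 1 <= b%:R :> R by rewrite ler1n.
have Np2 : 0 < N * p ^+ 2 by rewrite mulr_gt0 ?exprn_gt0.
have kE : k * N * p ^+ 3 = k * p * (N * p ^+ 2) by ring.
have := g_pr.1 v; rewrite !natrM.
have NE : N = b%:R + (deg g v)%:R + 1.
  rewrite -natrD natr1 /b; congr _%:R.
  move: b_gt0; rewrite -addnS /b -subnDA addn1 subn_gt0 => /ltnW ?.
  by rewrite subnK.
have -> : b.-1%:R = b%:R - 1 :> R by rewrite -subn1 natrB.
set B := b%:R in b1 NE *; set d := (deg g v)%:R in NE *.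
set X := x%:R; set Y := y%:R.
set t := k * N * p ^+ 3 => dN xd yb.
have t_le : t <= 100^-1 * (N * p ^+ 2).
  by rewrite /t kE ler_wpM2r ?(ltW Np2).
have t_p : p * t <= t by rewrite ger_pMl// (lt_le_trans _ k_large).
have B0 : 0 <= B by lra.
have X_ge : 98/100 * (N * p ^+ 2) * B <= X.
  move: xd; rewrite ler_norml => /andP[+ _].
  have : (99/100 * N * p) * p * B <= d * p * B.
    rewrite !ler_wpM2r ?(ltW p0)//.
    move: dN; rewrite ler_norml => /andP[+ _].
    have : N * p ^+ 2 <= N * p by rewrite ler_wpM2l ?(ltW N0)// expr2 ger_pMr.
    by lra.
  have := ler_wpM2r B0 t_le; lra.
have X0 : 0 < X.
  by apply: lt_le_trans X_ge; rewrite !mulr_gt0 ?exprn_gt0//; lra.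
have x0 : x != 0%N by rewrite -(pnatr_eq0 R) gt_eqF.
split => //; rewrite natrD -/X -/Y.
have -> : (X + Y) / X - p^-1 = ((Y - p * (B * (B - 1)))
    - (p^-1 - 1) * (X - p * (d * B)) + B * (p * (N - 2) - d)) / X.
  by rewrite NE; field; rewrite !gt_eqF.
rewrite normrM normfV [`|X|]gtr0_norm// ler_pdivrMr//.
have pV : 1 <= p^-1 by rewrite invf_ge1.
have pX : `|(p^-1 - 1) * (X - p * (d * B))| <= p^-1 * (t * B).
  rewrite normrM ler_pM// ger0_norm ?subr_ge0//; by rewrite gerBl.
have dB : `|B * (p * (N - 2) - d)| <= 3 * (t * B).
  rewrite normrM ger0_norm// mulrC mulrA ler_wpM2r//.
  have t1 : 1 <= t := k_large.
  move: dN; rewrite !ler_norml => /andP[? ?].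
  by apply/andP; split; move: p0 p1; lra.
have tB : t * B <= p^-1 * (t * B).
  by rewrite ler_peMl// mulr_ge0// ltW// (lt_le_trans _ k_large).
apply: (@le_trans _ _ (5 * (p^-1 * (t * B)))).
  have := ler_normD (Y - p * (B * (B - 1)) - (p^-1 - 1) * (X - p * (d * B)))
    (B * (p * (N - 2) - d)).
  have := ler_normB (Y - p * (B * (B - 1))) ((p^-1 - 1) * (X - p * (d * B))).
  lra.
have -> : 5 * (p^-1 * (t * B)) = 5 * k * (N * p ^+ 2 * B).
  by rewrite /t; field; rewrite gt_eqF.
have := ler_wpM2l (ltW k0) X_ge.
have : 0 <= k * (N * p ^+ 2 * B).
  by rewrite mulr_ge0 ?(ltW k0)// mulr_ge0 ?(ltW Np2).
lra.
Qed.

Lemma hitting_time_near (v w : V) (x y : nat) (b := (#|V| - deg g v - 1)%N) :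
  w != v ->
  ((0 < b)%N -> `|x%:R - p * (deg g v * b)%:R| <= k * N * p ^+ 3 * b%:R) ->
  ((0 < b)%N -> `|y%:R - p * (b * b.-1)%:R| <= k * N * p ^+ 3 * b%:R) ->
  (~~ adj g w v -> x != 0%N) /\
  (`| expected_hit R g w v -
      ((2 * #|edges g|)%:R / (deg g v)%:R - 1
       + (x + y)%:R / x%:R * (~~ adj g w v)%:R)%:E | <= (68 * k)%:E)%E.
Proof.
move=> wv xb yb.
have [U [-> Uv U_eq]] := expected_hit_system R
  (fun u (uv : u != v) => pseudorandom_codeg_gt0 uv).
have := poisson_near p01 k_small k_large g_pr.1 g_pr.2 Uv U_eq wv.
rewrite handshake natr_sum -EFinB abse_EFin lee_fin.
case: (boolP (adj g w v)) => [gwv|ngwv] /= near_U.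
  split => //; move: near_U; rewrite mul0r mulr0 => /le_trans; apply.
  by move: k0; lra.
have b0 : (0 < b)%N.
  rewrite /b -subnDA addn1 subn_gt0.
  have : ([set w; v] :|: [set u | adj g v u] \subset [set: V])%SET.
    exact: finset.subsetT.
  move=> /subset_leq_card; rewrite cardsT cardsU.
  rewrite (_ : _ :&: _ = finset.set0)%SET ?cards0 ?subn0.
    by rewrite cards2 wv.
  apply/finset.setP => u; rewrite !inE; apply/negbTE/andP => -[/orP[]/eqP->].
    by rewrite adj_sym (negbTE ngwv).
  by rewrite adj_irr.
have [x0 xy] := count_ratio_near b0 (xb b0) (yb b0).
split => //; rewrite mulr1.
set a := (_ + _)%:R / _ in xy *; set c := _ / _ - 1 in near_U *.
have -> : U w - (c + a) = U w - (c + 1 / p) - (a - p^-1) by rewrite mul1r; ring.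
by have := ler_normB (U w - (c + 1 / p)) (a - p^-1); move: k0; lra.
Qed.
End Deterministic.

(** * Chernoff bound *)

(** From exp(-s) >= 1 - s and (1 - s) (1 + s + 2 s^2) >= 1. *)
Lemma expR_le_quadratic (R : realType) (s : R) :
  s <= 2^-1 -> expR s <= 1 + s + 2 * s ^+ 2.
Proof.
move=> s_le.
have e1 : 1 - s <= expR (- s) by exact: expR_ge1Dx.
have : expR s * (1 - s) <= 1.
  rewrite -[leRHS](@mulfV _ (expR s)) ?gt_eqF ?expR_gt0//.
  by rewrite -expRN ler_wpM2l ?expR_ge0.
have : (1 + s + 2 * s ^+ 2) * (1 - s) = 1 + s ^+ 2 * (1 - 2 * s) by ring.
have : 0 <= s ^+ 2 * (1 - 2 * s) by rewrite mulr_ge0 ?sqr_ge0//; lra.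
move=> ? e2 ?; rewrite -(@ler_pM2r _ (1 - s)); last by lra.
by rewrite e2; lra.
Qed.

(** Concentration for a variable that is binomial only through its moment
    generating function: this covers both counts of independent events and the
    distribution [binomial_prob]. *)
Section Chernoff.
Context d (T : measurableType d) (R : realType) (P : probability T R).
Variables (Z : T -> R) (m : nat) (r : R).
Hypotheses (mZ : measurable_fun setT Z) (r01 : 0 <= r <= 1)
  (mgf : forall s, (\int[P]_x (expR (s * Z x))%:E
                    = ((1 + r * (expR s - 1)) ^+ m)%:E)%E).

Lemma exp_markov (A : set T) (s c : R) : measurable A ->
  (forall x, A x -> c <= s * Z x) ->
  (P A <= ((1 + r * (expR s - 1)) ^+ m * expR (- c))%:E)%E.
Proof.
move=> mA Ac.
have mexp : measurable_fun setT (EFin \o (fun x => expR (s * Z x))).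
  apply/measurable_EFinP; apply: measurableT_comp => //.
  exact: measurable_funM.
rewrite EFinM -mgf -ge0_integralZr//.
rewrite -[X in P X]setIT -integral_indic//.
apply: ge0_le_integral => //.
- exact/measurable_EFinP.
- exact: emeasurable_funM.
move=> x _; rewrite -EFinM lee_fin indicE -expRD.
have [xA|_] := boolP (x \in A); last by rewrite expR_ge0.
rewrite -expR0 ler_expR subr_ge0; exact/Ac/set_mem.
Qed.

Lemma mgf_le (s : R) : s <= 2^-1 ->
  (1 + r * (expR s - 1)) ^+ m <= expR (m%:R * (r * s + 2 * s ^+ 2)).
Proof.
move=> s_le; have /andP[r0 r1] := r01.
rewrite [m%:R * _]mulrC expRM_natr lerXn2r ?nnegrE ?expR_ge0//.
  have : r * expR s >= 0 by rewrite mulr_ge0 ?expR_ge0.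
  by lra.
apply: le_trans (expR_ge1Dx _); rewrite lerD2l.
have := ler_wpM2l r0 (expR_le_quadratic s_le).
have : r * s ^+ 2 <= s ^+ 2 by rewrite ler_piMl ?sqr_ge0.
by lra.
Qed.

(** Chernoff bound at the exponent s = t / (4 M), for which the bound
    exp(2 M s^2 - s t) is exp(- t^2 / (8 M)). The condition 8 l <= M keeps
    s <= 1/2, the range of [expR_le_quadratic]. *)
Lemma binomial_tail (M l : R) : m%:R <= M -> 0 < M -> 0 <= l -> 8 * l <= M ->
  (P [set x | (Num.sqrt (32 * M * l) < `|Z x - m%:R * r|)%R] <=
   (2 * expR (- (4 * l)))%:E)%E.
Proof.
move=> mM M0 l0 lM; set t := Num.sqrt _.
have t0 : 0 <= t by exact: sqrtr_ge0.
have t2 : t ^+ 2 = 32 * M * l by rewrite sqr_sqrtr// mulr_ge0// mulr_ge0// ltW.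
have t_le : t <= 2 * M.
  rewrite -(@ler_pXn2r _ 2)// ?nnegrE ?mulr_ge0 ?(ltW M0)//.
  rewrite t2 exprMn expr2 [M ^+ 2]expr2.
  by have := ler_wpM2l (ltW M0) lM; lra.
pose s := t / (4 * M).
have s0 : 0 <= s by rewrite mulr_ge0// invr_ge0 mulr_ge0// ltW.
have s_le : s <= 2^-1 by rewrite ler_pdivrMr ?mulr_gt0//; lra.
have sM : 2 * M * s ^+ 2 - s * t = - (4 * l).
  have -> : 2 * M * s ^+ 2 - s * t = - (t ^+ 2 / (8 * M)).
    by rewrite /s; field; rewrite gt_eqF.
  by rewrite t2; field; rewrite gt_eqF.
have tail (A : set T) u : measurable A -> u <= 2^-1 -> u ^+ 2 = s ^+ 2 ->
    (forall x, A x -> u * (m%:R * r) + s * t <= u * Z x) ->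
    (P A <= (expR (- (4 * l)))%:E)%E.
  move=> mA u_le us Au; apply: le_trans (exp_markov mA Au) _.
  rewrite lee_fin; apply: (@le_trans _ _ (expR (m%:R * (r * u + 2 * u ^+ 2)) *
    expR (- (u * (m%:R * r) + s * t)))).
    by rewrite ler_wpM2r ?expR_ge0 ?mgf_le.
  rewrite -expRD ler_expR -sM us.
  have := ler_wpM2r (sqr_ge0 s) mM; lra.
have mU : measurable [set x | m%:R * r + t <= Z x].
  rewrite -[X in measurable X]setTI; exact: measurable_fun_le.
have mL : measurable [set x | Z x <= m%:R * r - t].
  rewrite -[X in measurable X]setTI; exact: measurable_fun_le.
apply: (@le_trans _ _
  (P ([set x | (m%:R * r + t <= Z x)%R] `|` [set x | (Z x <= m%:R * r - t)%R]))).
  apply: le_measure; rewrite ?inE.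
  - rewrite (_ : mkset _ =
      ~` (setT `&` [set x | `|Z x - m%:R * r| <= t])); last first.
      by rewrite setTI; apply/seteqP; split => x /=; rewrite ltNge => /negP.
    apply: measurableC; apply: measurable_fun_le => //.
    by apply: measurableT_comp => //; apply: measurable_funB.
  - exact: measurableU.
  move=> x /=; case: (lerP 0 (Z x - m%:R * r)) => Zx.
    by rewrite ger0_norm// => ?; left; lra.
  by rewrite ltr0_norm// => ?; right; lra.
apply: le_trans (measureU2 _ mU mL) _.
have -> : 2 * expR (- (4 * l)) = expR (- (4 * l)) + expR (- (4 * l)) by ring.
rewrite EFinD; apply: leeD.
  by apply: (tail _ s) => // x /= Zx; rewrite -mulrDr ler_wpM2l.
apply: (tail _ (- s)) => //; first by lra.
  by rewrite sqrrN.
by move=> x /= /(ler_wpM2l s0); lra.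
Qed.

End Chernoff.

Lemma binomial_prob_mgf (R : realType) (m : nat) (r s : R) : 0 <= r <= 1 ->
  (\int[binomial_prob m r]_k (expR (s * k%:R))%:E
   = ((1 + r * (expR s - 1)) ^+ m)%:E)%E.
Proof.
move=> /andP[r0 r1]; rewrite (@integral_binomial _ m r r0 r1) => [|k]; last first.
  by rewrite lee_fin expR_ge0.
under eq_bigr do rewrite -EFinM.
rewrite sumEFin; congr EFin.
have -> : 1 + r * (expR s - 1) = (1 - r) + r * expR s by ring.
rewrite exprDn; apply: eq_bigr => k _ /=.
by rewrite exprMn -expRM_natr -!mulrnAl; ring.
Qed.

Lemma binomial_prob_tail (R : realType) (m : nat) (r M l : R) : 0 <= r <= 1 ->
  m%:R <= M -> 0 < M -> 0 <= l -> 8 * l <= M ->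
  (binomial_prob m r [set k | (Num.sqrt (32 * M * l) < `|k%:R - m%:R * r|)%R]
   <= (2 * expR (- (4 * l)))%:E)%E.
Proof.
move=> r01; apply: (binomial_tail (Z := fun k : nat => k%:R)) => // s.
exact: binomial_prob_mgf.
Qed.

(** * Concentration of degrees and codegrees *)

Lemma indic_bigcap (T : Type) (R : realType) (I : finType) (S : {set I})
    (A : I -> set T) x :
  \1_(\bigcap_(i in [set` S]) A i) x = \prod_(i in S) \1_(A i) x :> R.
Proof.
rewrite indicE; have [xA|xA] := boolP (x \in _).
  rewrite big1// => i iS; rewrite indicE mem_set//.
  by move: xA; rewrite inE => /(_ i); apply.
have : ~ (forall i, i \in S -> A i x).
  by move=> h; move/negP: xA; apply; rewrite inE => i /h.
move=> /existsNP[i /not_implyP[iS Aix]].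
by rewrite (bigD1 i)//= indicE memNset// mul0r.
Qed.

Section Count.
Context d (T : measurableType d) (R : realType) (P : probability T R).
Variables (I : finType) (J : {set I}) (A : I -> set T) (r : R).
Hypotheses (mA : forall i, measurable (A i))
  (indep : forall S : {set I}, S \subset J ->
     P (\bigcap_(i in [set` S]) A i) = (r ^+ #|S|)%:E).

Let Z x : R := \sum_(i in J) \1_(A i) x.

(** exp(s Z) is the product of the 1 + c 1_A with c = exp(s) - 1. Expanding the
    product over subfamilies reduces its expectation to the probabilities of
    intersections, which the product rule gives. *)
Lemma count_mgf s :
  (\int[P]_x (expR (s * Z x))%:E = ((1 + r * (expR s - 1)) ^+ #|J|)%:E)%E.
Proof.
pose c := expR s - 1.
pose capA (S : {set I}) := \bigcap_(i in [set` S]) A i.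
have mcap S : measurable (capA S) by exact: fin_bigcap_measurable.
pose h (S : {set I}) : R := if S \subset J then c ^+ #|S| else 0.
have prodE (b : I -> R) :
    \prod_(i in J) (1 + c * b i) = \sum_S h S * \prod_(i in S) b i.
  rewrite (eq_bigr (fun i => c * b i + 1)); last by move=> i _; rewrite addrC.
  rewrite big_mkcond /=.
  rewrite (eq_bigr (fun i => (if i \in J then c * b i else 0) + 1)) => [|i _];
    last by case: ifP; rewrite ?add0r.
  rewrite bigA_distr; apply: eq_bigr => S _.
  rewrite -big_mkcond /= /h.
  case: ifPn => [/fintype.subsetP SJ|/fintype.subsetPn[i iS iJ]].
    rewrite -prodr_const -big_split /=; apply: eq_bigr => i iS.
    by rewrite SJ.
  by rewrite mul0r (bigD1 i)//= (negPf iJ) mul0r.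
have -> : ((1 + r * (expR s - 1)) ^+ #|J|)%:E = (\sum_S (h S * r ^+ #|S|)%:E)%E.
  rewrite sumEFin -prodr_const; congr EFin; rewrite -/c mulrC prodE.
  by apply: eq_bigr => S _; rewrite prodr_const.
rewrite (eq_integral (fun x => \sum_S ((h S)%:E * (\1_(capA S) x)%:E))%E).
  rewrite integral_sum//; last first.
    by move=> S; apply: integrableZl => //; exact: integrable_indic.
  apply: eq_bigr => S _; rewrite integralZl//; last exact: integrable_indic.
  rewrite integral_indic// setIT EFinM /h; case: ifPn => SJ; last by rewrite !mul0e.
  by congr (_ * _)%E; exact: indep.
move=> x _; under eq_bigr do rewrite -EFinM.
rewrite sumEFin; congr EFin.
under [RHS]eq_bigr do rewrite /capA indic_bigcap.
rewrite -prodE mulr_sumr expR_sum; apply: eq_bigr => i _.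
rewrite indicE; case: (x \in A i); rewrite ?mulr1 ?mulr0 ?expR0 ?addr0//.
by rewrite /c subrKC.
Qed.

Lemma count_tail (M l : R) : 0 <= r <= 1 ->
  (#|J|%:R <= M)%R -> (0 < M)%R -> 0 <= l -> 8 * l <= M ->
  (P [set x | (Num.sqrt (32 * M * l) < `|Z x - #|J|%:R * r|)%R]
   <= (2 * expR (- (4 * l)))%:E)%E.
Proof.
move=> r01; apply: binomial_tail => //; last exact: count_mgf.
rewrite /Z; under eq_fun do rewrite -big_enum /=.
by apply: measurable_sum => i; exact: measurable_indic.
Qed.

End Count.

Section ErdosRenyi.
Context (R : realType) d (T : measurableType d) (P : probability T R).
Variables (n : nat) (p : R) (G : T -> sgraph 'I_n).
Hypotheses (p01 : 0 < p <= 1) (G_er : erdos_renyi P p G).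

Let E (e : 'I_n * 'I_n) := [set x | adj (G x) e.1 e.2].

Let mE e : measurable (E e). Proof. by case: G_er => mE _ _; exact: mE. Qed.

(** The orientation under which independence of the edges is stated. *)
Definition sort_pair (a b : 'I_n) := if (a < b)%N then (a, b) else (b, a).

Lemma sort_pair_lt a b : a != b -> ((sort_pair a b).1 < (sort_pair a b).2)%N.
Proof.
rewrite /sort_pair neq_ltn => /orP[ab|ba]; first by rewrite ab.
by case: ifP.
Qed.

Lemma sort_pair_inj a b c e : sort_pair a b = sort_pair c e ->
  (a = c /\ b = e) \/ (a = e /\ b = c).
Proof.
by rewrite /sort_pair; do 2!case: ifP => _; case=> -> ->; [left|right|right|left].
Qed.

Let E_sort a b : E (sort_pair a b) = E (a, b).
Proof.
rewrite /E /sort_pair; case: ifP => //= _.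
by apply/seteqP; split => x /=; rewrite adj_sym.
Qed.

Lemma edges_prob (S : {set 'I_n * 'I_n}) : (forall e, e \in S -> (e.1 < e.2)%N) ->
  P (\bigcap_(e in [set` S]) E e) = (p ^+ #|S|)%:E.
Proof.
have [_ PE ind] := G_er; move=> S_lt; rewrite ind//.
rewrite (eq_bigr (fun=> p%:E)) => [|e /S_lt elt].
  by rewrite prodEFin prodr_const.
by apply: PE; rewrite neq_ltn elt.
Qed.

Let indicE_adj a b x : \1_(E (a, b)) x = (adj (G x) a b)%:R :> R.
Proof. by rewrite indicE; congr (nat_of_bool _)%:R; apply/idP/idP; rewrite inE. Qed.

Lemma deg_tail (w : 'I_n) (M l : R) :
  ((n.-1)%:R <= M)%R -> (0 < M)%R -> 0 <= l -> 8 * l <= M ->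
  (P [set x | (Num.sqrt (32 * M * l) < `|(deg (G x) w)%:R - (n.-1)%:R * p|)%R]
   <= (2 * expR (- (4 * l)))%:E)%E.
Proof.
have degE x : (deg (G x) w)%:R = \sum_(u in [set~ w]%SET) \1_(E (w, u)) x :> R.
  rewrite -sum_adj (bigD1 w)//= adj_irr add0r.
  by apply: eq_big => [u|u _]; rewrite ?inE// indicE_adj.
under [X in P X]eq_set => x do rewrite degE.
have <- : #|[set~ w]%SET| = n.-1 by rewrite cardsC1 card_ord.
apply: count_tail => // [S Sw|]; last by case/andP: p01 => /ltW-> ->.
pose S' := [set sort_pair w u | u in S]%SET.
have <- : #|S'| = #|S|.
  by apply: card_imset => u1 u2 /sort_pair_inj[[_ ->]//|[-> ->]].
rewrite -edges_prob => [|_ /imsetP[u uS ->]]; last first.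
  by apply: sort_pair_lt; have := fintype.subsetP Sw u uS; rewrite !inE eq_sym.
congr (P _); apply/seteqP; split => [x Ex _ /imsetP[u uS ->]|x Ex u uS].
  by rewrite E_sort; exact: Ex.
by rewrite -E_sort; apply: Ex; exact: imset_f.
Qed.

(** The common neighbours u of w and z come from pairwise disjoint pairs of edges
    {w, u}, {z, u}, whence independent events of probability p^2. *)
Lemma codeg_tail (w z : 'I_n) (M l : R) : w != z ->
  ((n.-2)%:R <= M)%R -> (0 < M)%R -> 0 <= l -> 8 * l <= M ->
  (P [set x | (Num.sqrt (32 * M * l)
                 < `|(codeg (G x) w z)%:R - (n.-2)%:R * p ^+ 2|)%R]
   <= (2 * expR (- (4 * l)))%:E)%E.
Proof.
move=> wz; pose J := (~: [set w; z])%SET.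
have codegE x : (codeg (G x) w z)%:R =
    \sum_(u in J) \1_(E (w, u) `&` E (z, u)) x :> R.
  rewrite /codeg -sum1_card natr_sum big_mkcond [RHS]big_mkcond /=.
  apply: eq_bigr => u _; rewrite !inE indicI /= !indicE_adj negb_or.
  have [->|uw] := eqVneq u w; first by rewrite adj_irr.
  have [->|uz] := eqVneq u z; first by rewrite adj_irr andbF.
  by rewrite /= [adj _ u z]adj_sym; do 2!case: adj; rewrite /= ?mulr0 ?mulr1.
under [X in P X]eq_set => x do rewrite codegE.
have <- : #|J| = n.-2.
  have /(congr1 (predn \o predn)) := cardsC [set w; z]%SET.
  by rewrite cards2 wz card_ord.
have [p0 p1] := andP p01.
apply: count_tail => [u|S SJ|]; last first.
- by rewrite exprn_ge0 ?exprn_ile1// ltW.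
- pose S' := ([set sort_pair w u | u in S] :|: [set sort_pair z u | u in S])%SET.
  have SwP u : u \in S -> (w != u) && (z != u).
    by move=> /(fintype.subsetP SJ); rewrite !inE negb_or ![_ == u]eq_sym.
  have cS' : #|S'| = (2 * #|S|)%N.
    rewrite cardsU !card_imset => [|a b|a b]; last 2 first.
    + by move=> /sort_pair_inj[[_ ->]//|[-> ->]].
    + by move=> /sort_pair_inj[[_ ->]//|[-> ->]].
    rewrite (_ : _ :&: _ = finset.set0)%SET ?cards0 ?subn0 ?mul2n ?addnn//.
    apply/finset.setP => e; rewrite !inE; apply/negbTE/negP.
    move=> /andP[/imsetP[a aS ->] /imsetP[b bS /sort_pair_inj[[wz' _]|[_ az]]]].
      by rewrite wz' eqxx in wz.
    by have := SwP _ aS; rewrite az eqxx andbF.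
  rewrite -exprM -cS' -edges_prob => [|e]; last first.
    by rewrite inE => /orP[]/imsetP[u /SwP/andP[? ?] ->]; exact: sort_pair_lt.
  congr (P _); apply/seteqP; split => [x Ex e|x Ex u uS].
    rewrite /= inE => /orP[]/imsetP[u uS ->]; rewrite E_sort.
      by have [] := Ex u uS.
    by have [] := Ex u uS.
  split; rewrite -E_sort; apply: Ex; rewrite /= inE imset_f ?orbT//.
- exact: measurableI.
Qed.

End ErdosRenyi.

(** * Independent pairs on an enlarged space *)

Lemma measurable_countable_preimage d (T : measurableType d) (C : countType)
    (f : T -> C) : (forall c, measurable (f @^-1` [set c])) ->
  forall A : set C, measurable (f @^-1` A).
Proof.
move=> mf A.
have -> : f @^-1` A = \bigcup_c (f @^-1` ([set c] `&` A)).
  apply/seteqP; split => x; first by move=> Afx; exists (f x).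
  by move=> [c _ [/= ->]].
apply: countable_bigcupT_measurable; first exact: countableP.
move=> c; have [cA|cA] := pselect (A c).
  by rewrite (setIidl _)// => _ ->.
rewrite (_ : _ `&` _ = set0) ?preimage_set0//.
by apply/seteqP; split => // x [-> /cA].
Qed.

Section ProductProbability.
Context d1 d2 (T1 : measurableType d1) (T2 : measurableType d2) (R : realType).
Variables (P : probability T1 R) (Q : probability T2 R).

Definition product_probability : set (T1 * T2) -> \bar R := (P \x Q)%E.

HB.instance Definition _ := Measure.on product_probability.

Let product_probability_setT : product_probability setT = 1%E.
Proof.
rewrite -setXTT; transitivity (P setT * Q setT)%E.
  exact: product_measure1E.
by rewrite !probability_setT mule1.
Qed.

HB.instance Definition _ := Measure_isProbability.Build _ _ _
  product_probability product_probability_setT.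

Lemma product_probabilityE A B : measurable A -> measurable B ->
  product_probability (A `*` B) = (P A * Q B)%E.
Proof. exact: product_measure1E. Qed.

End ProductProbability.

(** A product with one more copy of nat * nat for each new pair. *)
Lemma independent_pairs (R : realType) (mu nu : nat -> probability nat R) m :
  exists d (S : measurableType d) (Q : probability S R) (X Y : nat -> S -> nat),
    [/\ forall k, measurable_fun setT (X k),
        forall k, measurable_fun setT (Y k)
      & forall k A B, (k < m)%N ->
        Q (X k @^-1` A `&` Y k @^-1` B) = (mu k A * nu k B)%E].
Proof.
elim: m => [|m [d [S [Q [X [Y [mX mY XY]]]]]]].
  by exists _, nat, (mu 0%N), (fun _ _ => 0%N), (fun _ _ => 0%N).
exists _, (S * (nat * nat))%type,
  (product_probability Q (product_probability (mu m) (nu m))).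
exists (fun k x => if k == m then x.2.1 else X k x.1).
exists (fun k x => if k == m then x.2.2 else Y k x.1).
split => [k|k|k A B]; first 2 last.
- rewrite ltnS leq_eqVlt; case: (k =P m) => [-> _|_ /= km].
    rewrite (_ : _ `&` _ = setT `*` (A `*` B)); last first.
    by apply/seteqP; split => [[s [a b]] [/= Aa Bb]|[s [a b]] [_ []]].
    have mAB : measurable (A `*` B) by exact: measurableX.
    apply: etrans (product_probabilityE _ _ measurableT mAB) _.
    by rewrite probability_setT mul1e; exact: product_probabilityE.
  rewrite (_ : _ `&` _ = (X k @^-1` A `&` Y k @^-1` B) `*` setT).
    have mXY : measurable (X k @^-1` A `&` Y k @^-1` B).
      by apply: measurableI; rewrite -[_ @^-1` _]setTI; [exact: mX|exact: mY].
    apply: etrans (product_probabilityE _ _ mXY measurableT) _.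
    by rewrite XY// probability_setT mule1.
  by apply/seteqP; split => [[s ab] [/= ? ?]|[s ab] [[/= ? ?] _]].
- case: (k == m); first exact: measurableT_comp.
  exact: measurableT_comp.
- case: (k == m); first exact: measurableT_comp.
  exact: measurableT_comp.
Qed.

(** One independent pair of variables is drawn for every possible value k, and
    the pair of index i uses the draw of the value taken by [D i]. *)
Lemma enlargement_pairs (R : realType) d (T : measurableType d)
    (P : probability T R) (I : Type) (D : I -> T -> nat) (m : nat)
    (mu nu : nat -> probability nat R) :
  (forall i k, measurable (D i @^-1` [set k])) ->
  exists d' (T' : measurableType d') (P' : probability T' R) (pi : T' -> T)
    (X Y : I -> {RV P' >-> nat}),
    enlargement P P' pi /\
    forall i k A B, (k < m)%N ->
      P' (X i @^-1` A `&` Y i @^-1` B `&` (D i \o pi) @^-1` [set k])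
        = (P (D i @^-1` [set k]) * (mu k A * nu k B))%E.
Proof.
move=> mD; have [dS [S [Q [X [Y [mX mY XY]]]]]] := independent_pairs mu nu m.
have mix (Z : nat -> S -> nat) i : (forall k, measurable_fun setT (Z k)) ->
    measurable_fun setT (fun x : T * S => Z (D i x.1) x.2).
  move=> mZ _ A _; rewrite setTI.
  rewrite (_ : _ @^-1` _ = \bigcup_k (D i @^-1` [set k] `*` Z k @^-1` A)).
    apply: bigcupT_measurable => k; apply: measurableX; first exact: mD.
    by rewrite -[_ @^-1` _]setTI; exact: mZ.
  apply/seteqP; split => [[t s] /= As|[t s] [k _ [/= -> //]]].
  by exists (D i t).
pose mfun_mix Z mZ i : {mfun (T * S)%type >-> nat} :=
  mfun_Sub (mem_set (mix Z i mZ)).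
exists _, (T * S)%type, (product_probability P Q), fst.
exists (mfun_mix X mX), (mfun_mix Y mY); split.
  split => [|A mA]; first exact: measurable_fst.
  rewrite /pushforward (_ : _ @^-1` _ = A `*` setT).
    apply: etrans (product_probabilityE _ _ mA measurableT) _.
    by rewrite probability_setT mule1.
  by apply/seteqP; split => [[t s] //|[t s] []].
move=> i k A B km.
have mXY : measurable (X k @^-1` A `&` Y k @^-1` B).
  by apply: measurableI; rewrite -[_ @^-1` _]setTI; [exact: mX|exact: mY].
rewrite -XY//; apply: etrans (product_probabilityE _ _ (mD i k) mXY).
congr (product_probability _ _ _).
by apply/seteqP; split => [[t s] [/= [+ +] tk]|[t s] [/= -> []]]; rewrite ?tk.
Qed.

(** * The estimate for one size *)

Lemma sgraph_eq (V : finType) (g h : sgraph V) : adj g =2 adj h -> g = h.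
Proof.
case: g h => [a a_sym a_irr] [b b_sym b_irr] /= /funeq2P ab.
move: a_sym a_irr; rewrite ab => a_sym a_irr.
by congr SGraph; exact: Prop_irrelevance.
Qed.

(** There are countably many values of the graph and of the two families of
    counts, so every property of them is an event. *)
Lemma measurable_graph_counts d (T : measurableType d) (n : nat)
    (g : T -> sgraph 'I_n) (X Y : 'I_n -> T -> nat)
    (Q : sgraph 'I_n -> ('I_n -> nat) -> ('I_n -> nat) -> Prop) :
  (forall e : 'I_n * 'I_n, measurable [set x | adj (g x) e.1 e.2]) ->
  (forall v k, measurable (X v @^-1` [set k])) ->
  (forall v k, measurable (Y v @^-1` [set k])) ->
  measurable [set x | Q (g x) (X^~ x) (Y^~ x)].
Proof.
move=> mg mX mY.
pose f x := ([ffun e : 'I_n * 'I_n => adj (g x) e.1 e.2],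
  [ffun v => X v x], [ffun v => Y v x]).
have mf c : measurable (f @^-1` [set c]).
  case: c => [[a b] c].
  have -> : f @^-1` [set (a, b, c)] =
      (\bigcap_(e in [set: 'I_n * 'I_n]) [set x | adj (g x) e.1 e.2 = a e])
      `&` (\bigcap_(v in [set: 'I_n]) (X v @^-1` [set b v]))
      `&` (\bigcap_(v in [set: 'I_n]) (Y v @^-1` [set c v])).
    apply/seteqP; split => x /=.
      by case=> <- <- <-; split; [split|] => e _ /=; rewrite ffunE.
    move=> [[xa xb] xc]; congr (_, _, _); apply/ffunP => e; rewrite ffunE.
    - exact: xa.
    - exact: xb.
    - exact: xc.
  apply: measurableI; [apply: measurableI|]; apply: fin_bigcap_measurable => //.
  move=> e _; case: (a e); first exact: mg.
  rewrite (_ : mkset _ = ~` [set x | adj (g x) e.1 e.2]).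
    exact: measurableC.
  by apply/seteqP; split => x /=; [move=> -> | move/negP/negbTE].
rewrite (_ : mkset _ =
  f @^-1` [set c | exists2 x, f x = c & Q (g x) (X^~ x) (Y^~ x)]).
  exact: measurable_countable_preimage.
apply/seteqP; split => x /=; first by exists x.
move=> [y [/ffunP yg /ffunP yX /ffunP yY]].
have -> : g y = g x.
  by apply: sgraph_eq => a b; have := yg (a, b); rewrite !ffunE.
have -> : X^~ y = X^~ x by apply/funext => v; have := yX v; rewrite !ffunE.
by have -> : Y^~ y = Y^~ x by apply/funext => v; have := yY v; rewrite !ffunE.
Qed.

Lemma union_bound d (T : measurableType d) (R : realType) (P : probability T R)
    (I : finType) (F : I -> set T) (A : set T) (c : R) :
  measurable A -> (forall i, measurable (F i)) ->
  (forall i, (P (F i) <= c%:E)%E) ->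
  (forall x, (forall i, ~ F i x) -> A x) ->
  ((1 - #|I|%:R * c)%:E <= P A)%E.
Proof.
move=> mA mF Fc FA.
pose U := \big[setU/set0]_(i : I) F i.
have [mU PU] : measurable U /\ (P U <= (#|I|%:R * c)%:E)%E.
  rewrite /U -sum1_card natr_sum mulr_suml -sumEFin.
  apply: (big_ind2 (fun (B : set T) (b : \bar R) => measurable B /\ (P B <= b)%E)).
  - by rewrite measure0.
  - move=> B b C e [mB Bb] [mC Ce]; split; first exact: measurableU.
    exact: le_trans (measureU2 _ mB mC) (leeD Bb Ce).
  - by move=> i _; rewrite mul1r.
have : (P (~` A) <= P U)%E.
  apply: le_measure; rewrite ?inE//; first exact: measurableC.
  move=> x nAx; apply: contrapT => nUx; apply: nAx; apply: FA => i Fix.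
  by apply: nUx; rewrite /U (bigD1 i)//=; left.
rewrite probability_setC// => /le_trans /(_ PU).
rewrite -[P A]fineK ?fin_num_measure// -EFinB !lee_fin; lra.
Qed.

Lemma enlargement_measure (R : realType) d d' (T : measurableType d)
    (T' : measurableType d') (P : probability T R) (P' : probability T' R)
    (pi : T' -> T) (A : set T) : enlargement P P' pi -> measurable A ->
  measurable (pi @^-1` A) /\ P' (pi @^-1` A) = P A.
Proof.
move=> [mpi piP] mA; split; last exact: piP.
by rewrite -[_ @^-1` _]setTI; exact: mpi.
Qed.

(** The data of an enlarged space in one type, over which they can be chosen
    simultaneously for all sizes n. *)
Record pair_extension (R : realType) d (T : measurableType d) (I : Type) :=
  PairExtension {
  ext_d : measure_display;
  ext_T : measurableType ext_d;
  ext_P : probability ext_T R;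
  ext_pi : ext_T -> T;
  ext_X : I -> {RV ext_P >-> nat};
  ext_Y : I -> {RV ext_P >-> nat} }.

Definition hitting_times_near (R : realType) (n : nat) (e : R)
    (g : sgraph 'I_n) (x y : 'I_n -> nat) : Prop :=
  connected_graph g /\
  forall w v : 'I_n, w != v ->
    (~~ adj g w v -> x v != 0%N) /\
    (`| expected_hit R g w v -
        ((2 * #|edges g|)%:R / (deg g v)%:R - 1
         + (x v + y v)%:R / (x v)%:R * (~~ adj g w v)%:R)%:E | <= e%:E)%E.

(** The parameter k of the deterministic estimate: sqrt(32 n ln n) is the deviation
    of degrees and codegrees that has probability at most 2 n^-4, and 2 accounts
    for means (n - 1) p and (n - 2) p^2 instead of n p and n p^2. *)
Definition error_scale (R : realType) (n : nat) (p : R) : R :=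
  (Num.sqrt (32 * n%:R * ln n%:R) + 2) / (n%:R * p ^+ 3).

Section OneSize.
Context (R : realType) (n : nat) (p : R).
Context d (T : measurableType d) (P : probability T R) (G : T -> sgraph 'I_n).
Hypotheses (p01 : 0 < p <= 1) (G_er : erdos_renyi P p G).

Let mG (e : 'I_n * 'I_n) : measurable [set x | adj (G x) e.1 e.2].
Proof. by case: G_er => mE _ _; exact: mE. Qed.

Let D (v : 'I_n) x := deg (G x) v.

Let measurable_graph (Q : sgraph 'I_n -> Prop) : measurable [set x | Q (G x)].
Proof.
apply: (measurable_graph_counts (X := fun _ _ => 0%N) (Y := fun _ _ => 0%N)
  (fun g _ _ => Q g)) => // v k;
  by rewrite -[_ @^-1` _]setTI; exact: measurable_cst.
Qed.

Let N1 k := (k * (n - k - 1))%N.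
Let N2 k := ((n - k - 1) * (n - k - 2))%N.

Lemma exists_extension :
  exists e : @pair_extension R d T 'I_n,
    [/\ enlargement P (ext_P e) (@ext_pi _ _ _ _ e),
        forall v : 'I_n, cond_indep_binomials (ext_P e)
            (fun omega => deg (G (ext_pi omega)) v) N1 N2 p
            (ext_X e v) (ext_Y e v)
      & (0 < n)%N -> error_scale n p <= 100^-1 ->
        ((1 - 4 * error_scale n p)%:E <=
         ext_P e [set omega | hitting_times_near (68 * error_scale n p)
           (G (ext_pi omega)) (fun v => ext_X e v omega)
           (fun v => ext_Y e v omega)] <= 1)%E].
Proof.
have [p0 p1] := andP p01.
have mD v k : measurable (D v @^-1` [set k]).
  exact: (measurable_graph (fun g => deg g v = k)).
have [d' [T' [P' [pi [X [Y [piP XYP]]]]]]] := enlargement_pairs P n.+1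
  (fun k => binomial_prob (N1 k) p) (fun k => binomial_prob (N2 k) p) mD.
have mpi A (mA : measurable A) := (enlargement_measure piP mA).1.
have Ppi A (mA : measurable A) := (enlargement_measure piP mA).2.
have Dn v x : (D v x < n.+1)%N by rewrite ltnS -[leqRHS]card_ord deg_leq.
exists (PairExtension pi X Y); split => //=.
  move=> v k.
  have -> : (fun omega => deg (G (pi omega)) v) @^-1` [set k] =
    (D v \o pi) @^-1` [set k] by [].
  rewrite (Ppi _ (mD v k)) => Pk.
  have kn : (k < n.+1)%N.
    rewrite ltnNge; apply/negP => nk; move/negP: Pk; apply.
    rewrite (_ : _ @^-1` _ = set0) ?measure0//.
    apply/seteqP; split => // x /= Dk.
    by have := Dn v x; rewrite Dk ltnS leqNgt nk.
  pose q := fine (P (D v @^-1` [set k])).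
  have qE : P (D v @^-1` [set k]) = q%:E by rewrite fineK// fin_num_measure.
  have q0 : q != 0 by apply: contraNneq Pk; rewrite qE => ->.
  have XY A B : cprob P' (X v @^-1` A `&` Y v @^-1` B) ((D v \o pi) @^-1` [set k]) =
      fine (binomial_prob (N1 k) p A) * fine (binomial_prob (N2 k) p B).
    rewrite /cprob XYP// (Ppi _ (mD v k)) qE.
    rewrite !fineM ?fin_numM ?fin_num_measure//=.
    by rewrite mulrC mulKf.
  have XA A : cprob P' (X v @^-1` A) ((D v \o pi) @^-1` [set k]) =
      fine (binomial_prob (N1 k) p A).
    by rewrite -[X v @^-1` A]setIT -(preimage_setT (Y v)) XY probability_setT mulr1.
  have YB B : cprob P' (Y v @^-1` B) ((D v \o pi) @^-1` [set k]) =
      fine (binomial_prob (N2 k) p B).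
    by rewrite -[Y v @^-1` B]setTI -(preimage_setT (X v)) XY probability_setT mul1r.
  by split => // A B; rewrite XY XA YB.
move=> n0; set k := error_scale n p => k_small.
pose N : R := n%:R; pose l : R := ln N.
have N0 : 0 < N by rewrite ltr0n.
have N1' : 1 <= N by rewrite ler1n.
have l0 : 0 <= l by exact: ln_ge0.
pose t := Num.sqrt (32 * N * l).
have t0 : 0 <= t by exact: sqrtr_ge0.
have Np3 : 0 < N * p ^+ 3 by rewrite mulr_gt0 ?exprn_gt0.
have kE : k * N * p ^+ 3 = t + 2 by rewrite -mulrA divfK ?gt_eqF.
have lN : 8 * l <= N.
  have tN : t <= 100^-1 * N.
    have : k * N * p ^+ 3 <= 100^-1 * (N * p ^+ 3).
      by rewrite -mulrA ler_wpM2r ?(ltW Np3).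
    have : N * p ^+ 3 <= N by rewrite ler_piMr ?(ltW N0)// exprn_ile1// ltW.
    by rewrite kE; lra.
  have t2 : t ^+ 2 = 32 * N * l by rewrite sqr_sqrtr// !mulr_ge0// ltW.
  have : t ^+ 2 <= (100^-1 * N) ^+ 2 by rewrite lerXn2r// nnegrE; lra.
  rewrite t2 (_ : 32 * N * l = N * (32 * l)); last by ring.
  rewrite (_ : (100^-1 * N) ^+ 2 = N * (N / 10000)); last by field.
  by rewrite ler_pM2l//; lra.
pose c : R := 2 * expR (- (4 * l)).
have cE : c = 2 / N ^+ 4.
  by rewrite /c expRN mulrC -[4]/(4%:R) mulrC expRM_natl lnK ?posrE.
pose b j := (n - j - 1)%N.
(* The events to avoid: a deviation of the degree of w, of the codegree of w and z,
   or of X w or Y w while the degree of w is z. *)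
pose F (i : 'I_4 * ('I_n * 'I_n)) : set T' :=
  let: (w, z) := i.2 in
  match val i.1 with
  | 0%N => pi @^-1` [set x | t < `|(deg (G x) w)%:R - n.-1%:R * p|]
  | 1%N => if w == z then set0 else
      pi @^-1` [set x | t < `|(codeg (G x) w z)%:R - n.-2%:R * p ^+ 2|]
  | 2%N => if (0 < b z)%N then
      X w @^-1` [set x | t * (b z)%:R < `|x%:R - (N1 z)%:R * p|]
        `&` (D w \o pi) @^-1` [set val z] else set0
  | _ => if (0 < b z)%N then
      Y w @^-1` [set y | t * (b z)%:R < `|y%:R - (N2 z)%:R * p|]
        `&` (D w \o pi) @^-1` [set val z] else set0
  end.
have mX v A : measurable (X v @^-1` A).
  by rewrite -[_ @^-1` _]setTI; exact: measurable_funPT.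
have mY v A : measurable (Y v @^-1` A).
  by rewrite -[_ @^-1` _]setTI; exact: measurable_funPT.
have mDpi v j : measurable ((D v \o pi) @^-1` [set j]) by exact: (mpi _ (mD v j)).
have mF i : measurable (F i).
  case: i => [[[|[|[|j]]] i4] [w z]]; rewrite /F /=.
  - by apply: mpi; exact: (measurable_graph
      (fun g => t < `|(deg g w)%:R - n.-1%:R * p|)).
  - case: (w == z); first exact: measurable0.
    apply: mpi; exact: (measurable_graph
      (fun g => t < `|(codeg g w z)%:R - n.-2%:R * p ^+ 2|)).
  - by case: ifP => _; [exact: measurableI|exact: measurable0].
  - by case: ifP => _; [exact: measurableI|exact: measurable0].
(* A deviation b t is the Chernoff deviation of scale M = N b^2, which bounds the
   numbers of trials of both counts. *)
have M_b z : (0 < b z)%N -> (b z)%:R * t = Num.sqrt (32 * (N * (b z)%:R ^+ 2) * l).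
  move=> _; rewrite /t; set B := _%:R.
  have -> : 32 * (N * B ^+ 2) * l = B ^+ 2 * (32 * N * l) by ring.
  by rewrite [RHS]sqrtrM ?sqr_ge0// sqrtr_sqr ger0_norm.
have M_le z : (0 < b z)%N -> N <= N * (b z)%:R ^+ 2.
  by move=> bz; rewrite ler_peMr ?(ltW N0)// exprn_ege1// ler1n.
have c0 : 0 <= c by rewrite mulr_ge0 ?expR_ge0.
have tail (z : 'I_n) m : (0 < b z)%N -> m%:R <= N * (b z)%:R ^+ 2 ->
    (binomial_prob m p [set x | (t * (b z)%:R < `|x%:R - m%:R * p|)%R] <= c%:E)%E.
  move=> bz mM; rewrite mulrC M_b//.
  have NM := M_le z bz; have M0 := lt_le_trans N0 NM.
  apply: binomial_prob_tail => //; first by rewrite ltW.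
  exact: le_trans lN NM.
have PF i : (P' (F i) <= c%:E)%E.
  case: i => [[[|[|[|j]]] i4] [w z]]; rewrite /F /=.
  - rewrite Ppi; last exact: (measurable_graph
      (fun g => t < `|(deg g w)%:R - n.-1%:R * p|)).
    by apply: (deg_tail p01 G_er) => //; rewrite ler_nat leq_pred.
  - case: ifPn => [_|wz]; first by rewrite measure0 lee_fin.
    rewrite Ppi; last exact: (measurable_graph
      (fun g => t < `|(codeg g w z)%:R - n.-2%:R * p ^+ 2|)).
    apply: (codeg_tail p01 G_er) => //.
    by rewrite ler_nat (leq_trans (leq_pred _) (leq_pred _)).
  - case: ifP => [bz|_]; last by rewrite measure0 lee_fin.
    rewrite -[X w @^-1` _]setIT -(preimage_setT (Y w)) XYP; last first.
      by rewrite ltnS ltnW.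
    rewrite probability_setT mule1; apply: le_trans (tail z (N1 z) bz _).
      by rewrite gee_pMl ?probability_le1 ?fin_num_measure// measure_ge0.
    rewrite /N1 -/(b z) natrM expr2 mulrA ler_wpM2r//.
    by rewrite -[leLHS]mulr1 ler_pM ?ler1n// ler_nat ltnW.
  - case: ifP => [bz|_]; last by rewrite measure0 lee_fin.
    rewrite -[Y w @^-1` _]setTI -(preimage_setT (X w)) XYP; last first.
      by rewrite ltnS ltnW.
    rewrite probability_setT mul1e; apply: le_trans (tail z (N2 z) bz _).
      by rewrite gee_pMl ?probability_le1 ?fin_num_measure// measure_ge0.
    apply: (@le_trans _ _ ((b z)%:R ^+ 2)); last by rewrite ler_peMl ?exprn_ge0.
    rewrite /N2 -/(b z) natrM expr2 ler_wpM2l// ler_nat /b -!subnDA leq_sub2l//.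
    by rewrite leq_add2l.
have kNp3 : 1 <= k * #|'I_n|%:R * p ^+ 3 by rewrite card_ord kE; lra.
set Ev := mkset _.
have mEv : measurable Ev.
  apply: (measurable_graph_counts (g := G \o pi) (X := X) (Y := Y)
    (hitting_times_near (68 * k))) => // e.
  exact: (mpi _ (mG e)).
have good x : (forall i, ~ F i x) -> Ev x.
  move=> nF; rewrite /Ev /=; set g := G (pi x).
  have deg_g w : `|(deg g w)%:R - n.-1%:R * p| <= t.
    by rewrite leNgt; apply/negP; exact: (nF (@Ordinal 4 0 isT, (w, w))).
  have codeg_g w z : w != z -> `|(codeg g w z)%:R - n.-2%:R * p ^+ 2| <= t.
    move=> wz; rewrite leNgt; apply/negP => wz_t.
    by apply: (nF (@Ordinal 4 1 isT, (w, z))); rewrite /F /= (negPf wz).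
  have g_pr : pseudorandom p k g.
    split=> [w|w z wz]; rewrite card_ord kE -/N.
      have -> : (deg g w)%:R - N * p = (deg g w)%:R - n.-1%:R * p - p.
        have -> : N = n.-1%:R + 1 by rewrite natr1 prednK.
        by ring.
      by have := ler_normB ((deg g w)%:R - n.-1%:R * p) p;
        rewrite [`|p|]gtr0_norm//; have := deg_g w; lra.
    have Nn : 0 <= N - n.-2%:R <= 2.
      rewrite subr_ge0 ler_nat (leq_trans (leq_pred _) (leq_pred _)) /=.
      by rewrite lerBlDr -natrD ler_nat; case: (n) => [|[|m]].
    have p2 : 0 <= p ^+ 2 <= 1 by rewrite exprn_ge0 ?exprn_ile1// ltW.
    have := ler_normB ((codeg g w z)%:R - n.-2%:R * p ^+ 2)
      ((N - n.-2%:R) * p ^+ 2).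
    rewrite [`|(N - _) * _|]ger0_norm; last first.
      by case/andP: Nn => ? _; case/andP: p2 => ? _; exact: mulr_ge0.
    have : (N - n.-2%:R) * p ^+ 2 <= 2 * 1.
      by case/andP: Nn => ? ?; case/andP: p2 => ? ?; exact: ler_pM.
    rewrite [X in `|X| <= _ -> _](_ : _ = (codeg g w z)%:R - N * p ^+ 2);
      last by ring.
    by have := codeg_g _ _ wz; lra.
  have deg_ord v : (0 < #|'I_n| - deg g v - 1)%N -> (deg g v < n)%N.
    by rewrite card_ord -subnDA subn_gt0 addn1 => /ltnW.
  split; first exact: (pseudorandom_connected p01 k_small kNp3 g_pr).
  move=> w v wv; apply: (hitting_time_near p01 k_small kNp3 g_pr wv) => bv.
    have vn := deg_ord v bv; rewrite card_ord kE.
    rewrite card_ord in bv.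
    have : `|(X v x)%:R - (N1 (deg g v))%:R * p| <= t * (b (deg g v))%:R.
      rewrite leNgt; apply/negP => Xt.
      apply: (nF (@Ordinal 4 2 isT, (v, Ordinal vn))).
      by rewrite /F /= /b bv.
    rewrite mulrC => /le_trans; apply; rewrite ler_wpM2r//; lra.
  have vn := deg_ord v bv; rewrite card_ord kE.
  rewrite card_ord in bv.
  have : `|(Y v x)%:R - (N2 (deg g v))%:R * p| <= t * (b (deg g v))%:R.
    rewrite leNgt; apply/negP => Xt.
    apply: (nF (@Ordinal 4 3 isT, (v, Ordinal vn))).
    by rewrite /F /= /b bv.
  rewrite /N2 -[(_ - _ - 2)%N]subnDA mulrC.
  rewrite (_ : (n - (deg g v + 2) = (n - deg g v - 1).-1)%N); last first.
    by rewrite -!subnDA -subnS addnS.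
  by move=> /le_trans; apply; rewrite ler_wpM2r//; lra.
rewrite probability_le1// andbT.
apply: le_trans (union_bound mEv mF PF good).
(* There are 4 n^2 events, and k >= 2 / n. *)
rewrite lee_fin lerD2l lerN2 !card_prod !card_ord !natrM cE -/N.
have -> : 4 * (N * N) * (2 / N ^+ 4) = 4 * (2 / N ^+ 2) by field; rewrite gt_eqF.
rewrite ler_pM2l// /k /error_scale -/N -/l -/t.
rewrite ler_pM ?invr_ge0 ?exprn_ge0 ?(ltW N0)//; first by lra.
rewrite lef_pV2 ?posrE ?exprn_gt0// expr2 ler_pM2l//.
by apply: le_trans N1'; rewrite exprn_ile1// ltW.
Qed.

End OneSize.

(** * Asymptotics *)

(** Up to a constant, the square of the scale is ln n / (n p^6), which is below
    the quantity that the hypothesis sends to 0. *)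
Lemma error_scale_cvg0 (R : realType) (p : nat -> R)
  (p01 : forall n, 0 < p n <= 1) :
  (fun n : nat => ln (n%:R : R) ^+ 5 * n%:R^-1 * p n ^- 8) @ \oo --> (0 : R) ->
  (fun n => error_scale n (p n)) @ \oo --> (0 : R).
Proof.
set a := fun n : nat => _ => a0.
have sa0 : (fun n => 8 * Num.sqrt (a n)) @ \oo --> (0 : R).
  rewrite -(mulr0 8) -(sqrtr0 R); apply: cvgMr.
  by apply: cvg_comp a0 _; exact: sqrt_continuous.
apply: (squeeze_cvgr _ (cvg_cst (0 : R)) sa0).
near=> n.
have [p0 p1] := andP (p01 n).
have n_large : expR 1 <= n%:R :> R by near: n; exact: nbhs_infty_ger.
have n0 : 0 < n%:R :> R by apply: lt_le_trans n_large; exact: expR_gt0.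
have n1 : 1 <= n%:R :> R by rewrite ler1n -(ltr0n R).
have l1 : 1 <= ln (n%:R : R).
  by move: n_large; rewrite -ler_ln ?posrE ?expR_gt0// expRK.
have np3 : 0 < n%:R * p n ^+ 3 by rewrite mulr_gt0 ?exprn_gt0.
apply/andP; split.
  by rewrite /error_scale mulr_ge0 ?invr_ge0 ?(ltW np3)// addr_ge0 ?sqrtr_ge0.
rewrite /error_scale ler_pdivrMr//.
set l := ln _ in l1 *; set N := n%:R in n1 n0 np3 l1 *.
set s := Num.sqrt (N * l).
have s1 : 1 <= s.
  rewrite -sqrtr1 ler_wsqrtr// -[leLHS]mulr1 ler_pM//.
have l0 : 0 <= l by lra.
have Nl0 : 0 <= N * l by rewrite mulr_ge0// ltW.
have s32 : Num.sqrt (32 * N * l) <= 6 * s.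
  rewrite -[leRHS]ger0_norm ?mulr_ge0 ?sqrtr_ge0// -sqrtr_sqr ler_wsqrtr//.
  by rewrite exprMn sqr_sqrtr//; lra.
have s_a : s <= Num.sqrt (a n) * (N * p n ^+ 3).
  rewrite -[N * p n ^+ 3]ger0_norm ?(ltW np3)// -sqrtr_sqr mulrC -sqrtrM ?sqr_ge0//.
  rewrite ler_wsqrtr//.
  have -> : (N * p n ^+ 3) ^+ 2 * a n = N * l * (l ^+ 4 / p n ^+ 2).
    by rewrite /a -/l -/N; field; rewrite !gt_eqF.
  rewrite ler_peMr// ler_pdivlMr ?exprn_gt0// mul1r.
  apply: (@le_trans _ _ 1); first by rewrite exprn_ile1// ltW.
  exact: exprn_ege1.
by rewrite -[leRHS]mulrA; lra.
Unshelve. all: by end_near. Qed.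

Theorem corollary1 (R : realType) (p : nat -> R)
  (p01 : forall n, 0 < p n <= 1)
  (p_large : (fun n : nat => ln (n%:R : R) ^+ 5 * n%:R^-1 * p n ^- 8) @ \oo --> (0 : R))
  (d : nat -> measure_display) (T : forall n, measurableType (d n))
  (P : forall n, probability (T n) R)
  (G : forall n, T n -> sgraph 'I_n)
  (G_er : forall n, erdos_renyi (P n) (p n) (G n)) :
  exists (d' : nat -> measure_display) (T' : forall n, measurableType (d' n))
         (P' : forall n, probability (T' n) R) (pi : forall n, T' n -> T n)
         (X Y : forall n, 'I_n -> {RV (P' n) >-> nat}) (eps : nat -> R),
    [/\ forall n, enlargement (P n) (P' n) (pi n),
        forall n (v : 'I_n),
          cond_indep_binomials (P' n)
            (fun omega => deg (G n (pi n omega)) v)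
            (fun k => k * (n - k - 1))%N
            (fun k => (n - k - 1) * (n - k - 2))%N
            (p n) (X n v) (Y n v),
        eps @ \oo --> (0 : R)
      & (fun n : nat => P' n [set omega |
          let g := G n (pi n omega) in
          connected_graph g /\
          forall w v : 'I_n, w != v ->
            let x : nat := X n v omega in
            let y : nat := Y n v omega in
            (~~ adj g w v -> x != 0%N) /\
            (`| expected_hit R g w v -
                ((2 * #|edges g|)%:R / (deg g v)%:R - 1
                 + (x + y)%:R / x%:R * (~~ adj g w v)%:R)%:E |
             <= (eps n)%:E)%E ]) @ \oo --> (1%:E : \bar R)].
Proof.
pose e n := projT1 (cid (exists_extension (p01 n) (G_er n))).
have eP n := projT2 (cid (exists_extension (p01 n) (G_er n))).
have k0 := error_scale_cvg0 p01 p_large.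
exists (fun n => ext_d (e n)), (fun n => ext_T (e n)), (fun n => ext_P (e n)).
exists (fun n => @ext_pi _ _ _ _ (e n)), (fun n => ext_X (e n)).
exists (fun n => ext_Y (e n)), (fun n => 68 * error_scale n (p n)).
split.
- by move=> n; have [] := eP n.
- by move=> n; have [] := eP n.
- by rewrite -[X in _ --> X](mulr0 68); exact: cvgMr.
have low : (fun n => (1 - 4 * error_scale n (p n))%:E) @ \oo --> (1%:E : \bar R).
  apply: cvg_EFin; first by near=> n.
  rewrite -[X in _ --> X](subr0 1); apply: cvgB; first exact: cvg_cst.
  by rewrite -[X in _ --> X](mulr0 4); exact: cvgMr.
apply: (squeeze_cvge _ low (cvg_cst (1%:E : \bar R))).
near=> n.
have [_ _ prob] := eP n.
apply: prob; first by near: n; exact: nbhs_infty_gt.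
near: n; have e0 : 0 < 100^-1 :> R by rewrite invr_gt0.
move/cvgrPdist_le : k0 => /(_ _ e0); apply: filterS => n.
by rewrite sub0r normrN; apply: le_trans; exact: ler_norm.
Unshelve. all: by end_near. Qed.
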